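(* Let $m\ge1$ be an integer and $\delta\in\mathbb{R}$. (i) If $\delta\ne1$, all the $\mathrm{Vect}(M)$-modules $\mathcal{D}^1_{\underline\lambda;\mu}$ having the same shift $\mu-|\underline\lambda|=\delta$ are isomorphic to each other. (ii) If $\delta\ne1,\tfrac32,2$, all the $\mathrm{Vect}(M)$-modules $\mathcal{D}^2_{\underline\lambda;\mu}$ having the same shift $\mu-|\underline\lambda|=\delta$ are isomorphic to each other, with the exception of the modules $$\mathcal{D}^2_{\underline 0;\delta}\simeq\mathcal{D}^2_{(1-\delta)\mathbf 1_1;1}\simeq\cdots\simeq\mathcal{D}^2_{(1-\delta)\mathbf 1_m;1},$$ which are isomorphic to one another and are singular.
   Context: $M$ is $\mathbb{R}$ or $S^1$. For $\lambda\in\mathbb{R}$, $\mathcal{F}_\lambda$ is the space of smooth $\lambda$-densities $a\,(dx)^\lambda$ on $M$, with the $\mathrm{Vect}(M)$-action $L_X^\lambda(a\,(dx)^\lambda)=(Xa'+\lambda X'a)(dx)^\lambda$ for $X=X(x)\partial_x$. For $\underline\lambda=(\lambda_1,\dots,\lambda_m)\in\mathbb{R}^m$ write $|\underline\lambda|=\sum_j\lambda_j$; $\mathbf 1_j$ is the tuple with $1$ in position $j$ and $0$ elsewhere. $\mathcal{D}^k_{\underline\lambda;\mu}$ is the space of $m$-ary differential operators of order $\le k$, $A=\sum_{|\underline i|\le k}a_{\underline i}\,\partial_{\underline i}:\mathcal{F}_{\lambda_1}\otimes\cdots\otimes\mathcal{F}_{\lambda_m}\to\mathcal{F}_\mu$,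 with $a_{\underline i}$ smooth functions and $\partial_{\underline i}(\varphi_1,\dots,\varphi_m)=\varphi_1^{(i_1)}\cdots\varphi_m^{(i_m)}$; it is a $\mathrm{Vect}(M)$-module via $L_X^{\underline\lambda;\mu}(A)=L_X^\mu\circ A-\sum_{j=1}^m A(\dots,L_X^{\lambda_j}(-),\dots)$. Permutations: interchanging the $i$-th and $j$-th arguments gives a $\mathrm{Vect}(M)$-isomorphism from $\mathcal{D}^k_{\underline\lambda;\mu}$ to the module with $\lambda_i$ and $\lambda_j$ interchanged. Conjugation: the map $A\mapsto A^*$ defined by $\int_M A(\varphi_1,\dots,\varphi_m)\phi=\int_M\varphi_1A^*(\varphi_2,\dots,\varphi_m,\phi)$ (compactly supported densities if $M=\mathbb{R}$) is a $\mathrm{Vect}(M)$-isomorphism $\mathcal{D}^k_{\lambda_1,\dots,\lambda_m;\mu}\to\mathcal{D}^k_{\lambda_2,\dots,\lambda_m,1-\mu;1-\lambda_1}$. A module $\mathcal{D}^k_{\underline\lambda;\mu}$ is called singular if it is isomorphic (as a $\mathrm{Vect}(M)$-module) only to itself, or only to modules $\mathcal{D}^k_{\underline\rho;\eta}$ obtained from it through compositions of conjugations and permutations. *)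

(* Defs.v *)
From HB Require Import structures.
From mathcomp Require Import all_boot all_order all_algebra perm.
From mathcomp Require Import all_classical all_reals all_analysis.
Set Implicit Arguments.
Unset Strict Implicit.
Unset Printing Implicit Defensive.
Import Order.TTheory GRing.Theory Num.Theory.
Import numFieldNormedType.Exports.
Local Open Scope ring_scope.
Local Open Scope classical_set_scope.

Variant curve := Line | Circle.

Section SmoothFunctions.
Variables (R : realType) (M : curve).
Implicit Types f g : R -> R.

(* The circle is R / 2 pi Z: its smooth functions are the 2 pi-periodic smooth
   functions on R. *)
Definition smooth f : Prop :=
  (forall n x, derivable (derive1n n f) x 1) /\
  match M with Line => True | Circle => periodic f (pi *+ 2) end.

Definition smooth_pred : {pred R -> R} := fun f => `[< smooth f >].

Lemma der1_smooth f : smooth f -> smooth (derive1 f).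
Proof.
move=> [df pf]; split; first by move=> n x; rewrite -derive1Sn; exact: df.
case: M pf => // pf x; rewrite /derive1.
by under eq_fun do rewrite addrA !pf.
Qed.

Lemma der1D f g : (forall x, derivable f x 1) -> (forall x, derivable g x 1) ->
  derive1 (f + g) = derive1 f + derive1 g.
Proof.
move=> df dg; apply/funext => x; rewrite !derive1E deriveD //.
by rewrite [RHS]/GRing.add /= !derive1E.
Qed.

Lemma der1Z (c : R) f : (forall x, derivable f x 1) ->
  derive1 (c *: f) = c *: derive1 f.
Proof.
move=> df; apply/funext => x; rewrite derive1E deriveZ //.
by rewrite [RHS]/GRing.scale /= derive1E.
Qed.

Lemma der1M f g : (forall x, derivable f x 1) -> (forall x, derivable g x 1) ->
  derive1 (f * g) = derive1 f * g + f * derive1 g.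
Proof.
move=> df dg; apply/funext => x; rewrite !derive1E deriveM //.
rewrite [RHS]/GRing.add /= [X in _ = X + _]/GRing.mul [X in _ = _ + X]/GRing.mul.
by rewrite /= !derive1E /GRing.scale /= addrC mulrC.
Qed.

Fixpoint diff_upto n f : Prop :=
  (forall x, derivable f x 1) /\
  if n is p.+1 then diff_upto p (derive1 f) else True.

Lemma smooth_diff f : (forall n x, derivable (derive1n n f) x 1) <->
  forall n, diff_upto n f.
Proof.
split=> [df n|df n].
  elim: n f df => [|n IH] f df; first by split=> //; exact: (df 0%N).
  split; first exact: (df 0%N).
  by apply: IH => p x; rewrite -derive1Sn; exact: df.
move: {df}(df n); elim: n f => [|n IH] f [df]; first by [].
by move=> /IH d x; rewrite derive1Sn.
Qed.

Lemma diff_uptoW n f : diff_upto n.+1 f -> diff_upto n f.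
Proof. by elim: n f => [|n IH] f [df] => [_|/IH]; split. Qed.

Lemma diff_uptoD n f g : diff_upto n f -> diff_upto n g -> diff_upto n (f + g).
Proof.
elim: n f g => [|n IH] f g [df f'] [dg g'].
  by split=> // x; exact: derivableD.
split; first by move=> x; exact: derivableD.
by rewrite der1D //; exact: IH.
Qed.

Lemma diff_uptoM n f g : diff_upto n f -> diff_upto n g -> diff_upto n (f * g).
Proof.
elim: n f g => [|n IH] f g sf sg; have [df f'] := sf; have [dg g'] := sg.
  by split=> // x; exact: derivableM.
split; first by move=> x; exact: derivableM.
rewrite der1M //; apply: diff_uptoD; apply: IH => //; exact: diff_uptoW.
Qed.

Lemma smooth_cst (c : R) : smooth (cst c).
Proof.
split; last by case: M.
apply/smooth_diff => n; elim: n c => [|n IH] c.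
  by split=> // x; exact: derivable_cst.
split; first by move=> x; exact: derivable_cst.
have -> : derive1 (cst c) = cst 0 :> (R -> R).
  by apply/funext => x; rewrite derive1_cst.
exact: IH.
Qed.

Lemma smoothD f g : smooth f -> smooth g -> smooth (f + g).
Proof.
move=> [/smooth_diff df pf] [/smooth_diff dg pg]; split.
  by apply/smooth_diff => n; apply: diff_uptoD.
by case: M pf pg => // pf pg x; congr (_ + _); [exact: pf|exact: pg].
Qed.

Lemma smoothM f g : smooth f -> smooth g -> smooth (f * g).
Proof.
move=> [/smooth_diff df pf] [/smooth_diff dg pg]; split.
  by apply/smooth_diff => n; apply: diff_uptoM.
by case: M pf pg => // pf pg x; congr (_ * _); [exact: pf|exact: pg].
Qed.

Lemma smooth_cstM (c : R) f : smooth f -> smooth (c *: f).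
Proof. exact: (smoothM (smooth_cst c)). Qed.

Lemma smooth_zmod : zmod_closed smooth_pred.
Proof.
split; first by apply/asboolP; exact: smooth_cst.
move=> f g /asboolP sf /asboolP sg; apply/asboolP.
by rewrite -scaleN1r; apply: smoothD => //; exact: smooth_cstM.
Qed.

Lemma smooth_mul : mulr_closed smooth_pred.
Proof.
split; first by apply/asboolP; exact: smooth_cst.
by move=> f g /asboolP sf /asboolP sg; apply/asboolP; exact: smoothM.
Qed.

Lemma smooth_scale : GRing.scaler_closed smooth_pred.
Proof. by move=> c f /asboolP sf; apply/asboolP; exact: smooth_cstM. Qed.

HB.instance Definition _ := GRing.isZmodClosed.Build _ smooth_pred smooth_zmod.
HB.instance Definition _ := GRing.isMulClosed.Build _ smooth_pred smooth_mul.
HB.instance Definition _ :=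
  GRing.isScaleClosed.Build R _ smooth_pred smooth_scale.

(* C^oo(M).  Using the coordinate x, it also serves as Vect(M), X standing for
   X(x) d/dx, and as the space of lambda-densities, a standing for
   a (dx)^lambda. *)
Record cinf := Cinf { cinf_fun :> R -> R; _ : cinf_fun \in smooth_pred }.

HB.instance Definition _ := [isSub for cinf_fun].
HB.instance Definition _ := [Choice of cinf by <:].
HB.instance Definition _ := [SubChoice_isSubComNzRing of cinf by <:].
HB.instance Definition _ := [SubZmodule_isSubLmodule of cinf by <:].

Lemma cinf_scaleAl (c : R) (f g : cinf) : c *: (f * g) = c *: f * g.
Proof. by apply/val_inj; apply/funext => x; exact: mulrA. Qed.

HB.instance Definition _ := GRing.Lmodule_isLalgebra.Build R cinf cinf_scaleAl.
HB.instance Definition _ := GRing.Lalgebra_isComAlgebra.Build R cinf.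

Lemma cinfP (f : cinf) : smooth f.
Proof. exact/asboolP/(valP f). Qed.

Lemma cinf_derivable (f : cinf) x : derivable f x 1.
Proof. by have [df _] := cinfP f; exact: (df 0%N). Qed.

Lemma der_subproof (f : cinf) : derive1 f \in smooth_pred.
Proof. exact/asboolP/der1_smooth/cinfP. Qed.

Definition der (f : cinf) : cinf := Cinf (der_subproof f).

Lemma derM (f g : cinf) : der (f * g) = der f * g + f * der g.
Proof. by apply/val_inj; apply: der1M; exact: cinf_derivable. Qed.

Lemma der_linear : linear der.
Proof.
move=> c f g; apply/val_inj.
transitivity (derive1 (c *: (f : R -> R) + (g : R -> R))); first by [].
have df := @cinf_derivable f; have dg := @cinf_derivable g.
rewrite der1D //; last by move=> x; exact: derivableZ.
by rewrite der1Z.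
Qed.

HB.instance Definition _ := GRing.isLinear.Build R cinf cinf _ der der_linear.

End SmoothFunctions.

Section Modules.
Variables (R : realType) (M : curve).
Local Notation C := (cinf R M).

(* L_X^lambda (a (dx)^lambda) = (X a' + lambda X' a) (dx)^lambda *)
Definition lie (lam : R) (X a : C) : C := X * der a + lam *: (der X * a).

Lemma lie_linear lam X : linear (lie lam X).
Proof.
move=> c f g; rewrite /lie linearP !mulrDr -!scalerAr !scalerDr addrACA.
by rewrite [lam *: (c *: _)]scalerA [lam * c]mulrC scalerA.
Qed.

HB.instance Definition _ lam X :=
  GRing.isLinear.Build R C C _ (lie lam X) (lie_linear lam X).

Section Operators.
Variables m k : nat.

Definition op := ('I_m -> C) -> C.
HB.instance Definition _ := GRing.Lmodule.on op.

(* a multi-index (i_1, ..., i_m) with every i_j <= k *)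
Definition midx := {ffun 'I_m -> 'I_k.+1}.

(* A (phi_1, ..., phi_m) =
   \sum_(|i| <= k) a_i phi_1^(i_1) ... phi_m^(i_m) *)
Definition is_diffop (A : op) : Prop :=
  exists a : midx -> C, forall phi, A phi =
    \sum_(i : midx | (\sum_j i j <= k)%N)
       a i * \prod_j iter (i j) (@der R M) (phi j).

Definition diffop_pred : {pred op} := fun A => `[< is_diffop A >].

Lemma is_diffop0 : is_diffop 0.
Proof.
by exists (fun=> 0) => phi; rewrite big1 // => i _; rewrite mul0r.
Qed.

Lemma is_diffopP (c : R) A B :
  is_diffop A -> is_diffop B -> is_diffop (c *: A + B).
Proof.
move=> [a Aa] [b Bb]; exists (fun i => c *: a i + b i) => phi.
rewrite [LHS]/GRing.add /= [in LHS]/GRing.scale /= Aa Bb scaler_sumr -big_split.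
by apply: eq_bigr => i _; rewrite mulrDl scalerAl.
Qed.

Lemma diffop_submod : GRing.submod_closed diffop_pred.
Proof.
split=> [|c A B /asboolP dA /asboolP dB]; apply/asboolP.
  exact: is_diffop0.
exact: is_diffopP.
Qed.

HB.instance Definition _ :=
  GRing.isSubmodClosed.Build R op diffop_pred diffop_submod.

(* D^k *)
Record diffop := Diffop { diffop_op :> op; _ : diffop_op \in diffop_pred }.

HB.instance Definition _ := [isSub for diffop_op].
HB.instance Definition _ := [Choice of diffop by <:].
HB.instance Definition _ := [SubChoice_isSubLmodule of diffop by <:].

(* (lambda, mu), with lambda in R^m *)
Definition weights := ('rV[R]_m * R)%type.

(* L_X^mu o A - \sum_j A (..., L_X^(lambda_j) (-), ...) *)
Definition lie_op (w : weights) (X : C) (A : op) : op := fun phi =>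
  lie w.2 X (A phi) -
  \sum_j A (fun l => if l == j then lie (w.1 0 j) X (phi j) else phi l).

Lemma lie_op_linear w X : linear (lie_op w X).
Proof.
move=> c A B; apply/funext => phi.
rewrite /lie_op [RHS]/GRing.add /= [in RHS]/GRing.scale /=.
rewrite [X in lie _ _ X]/GRing.add /= [in LHS]/GRing.scale /=.
rewrite linearP big_split /= -scaler_sumr scalerBr opprD addrACA.
by [].
Qed.

HB.instance Definition _ w X :=
  GRing.isLinear.Build R op op _ (lie_op w X) (lie_op_linear w X).

Lemma lie_iter lam (X : C) n : exists c : nat -> C, forall f : C,
  iter n (@der R M) (lie lam X f) =
  X * iter n.+1 (@der R M) f + \sum_(s < n.+1) c s * iter s (@der R M) f.
Proof.
elim: n => [|n [c IH]].
  by exists (fun=> lam *: der X) => f; rewrite big_ord1 /= -scalerAl.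
exists (fun s => (if s == n.+1 then der X else der (c s)) +
                 (if s is p.+1 then c p else 0)) => f.
rewrite iterS IH linearD /= derM linear_sum /= -addrA addrCA; congr (_ + _).
under eq_bigr do rewrite derM.
rewrite big_split /= addrA.
under [RHS]eq_bigr do rewrite mulrDl.
rewrite [RHS]big_split /=; congr (_ + _).
  rewrite [RHS]big_ord_recr /= eqxx addrC; congr (_ + _).
  by apply: eq_bigr => s _; rewrite ltn_eqF.
by rewrite [RHS]big_ord_recl /= mul0r add0r.
Qed.

Definition diffop_mono (a : C) (i : 'I_m -> nat) : op :=
  fun phi => a * \prod_j iter (i j) (@der R M) (phi j).

Lemma mono_diffop a i : (\sum_j i j <= k)%N -> is_diffop (diffop_mono a i).
Proof.
move=> ik; have ijk j : (i j <= k)%N.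
  by apply: leq_trans ik; rewrite (bigD1 j) //= leq_addr.
pose i0 : midx := [ffun j => inord (i j)].
have i0E j : i0 j = i j :> nat by rewrite ffunE inordK // ltnS.
exists (fun i' => if i' == i0 then a else 0) => phi.
rewrite (bigD1 i0) /=; last by under eq_bigr do rewrite i0E.
rewrite eqxx [X in _ + X]big1 ?addr0; last first.
  by move=> i' /andP[_ /negPf->]; rewrite mul0r.
by congr (_ * _); apply: eq_bigr => j _; rewrite i0E.
Qed.

Lemma diffopP A : reflect (is_diffop A) (A \in diffop_pred).
Proof. exact: asboolP. Qed.

Lemma der_prod (f : 'I_m -> C) :
  der (\prod_j f j) = \sum_j \prod_l (if l == j then der (f l) else f l).
Proof.
suff E (s : seq 'I_m) : uniq s -> der (\prod_(j <- s) f j) =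
    \sum_(j <- s) \prod_(l <- s) (if l == j then der (f l) else f l).
  by rewrite E ?index_enum_uniq.
elim: s => [_|j s IH /= /andP[js us]].
  rewrite !big_nil; apply/val_inj; apply/funext => x /=.
  exact: derive1_cst.
rewrite !big_cons derM IH // eqxx; congr (_ * _ + _).
  rewrite big_seq_cond [RHS]big_seq_cond; apply: eq_bigr => l.
  by rewrite andbT => ls; rewrite ifN //; apply: contraNneq js => <-.
rewrite mulr_sumr big_seq_cond [RHS]big_seq_cond; apply: eq_bigr => l.
rewrite andbT => ls; rewrite big_cons ifN //.
by apply: contraNneq js => ->.
Qed.

Lemma lie_op_mono w X a i :
  (\sum_j i j <= k)%N -> is_diffop (lie_op w X (diffop_mono a i)).
Proof.
move=> ik.
have /all_sig[c cE] j : {c : nat -> C | forall f : C,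
    iter (i j) (@der R M) (lie (w.1 0 j) X f) =
    X * iter (i j).+1 (@der R M) f +
    \sum_(s < (i j).+1) c s * iter s (@der R M) f}.
  exact/cid/lie_iter.
have -> : lie_op w X (diffop_mono a i) = diffop_mono (lie w.2 X a) i -
    \sum_j \sum_(s < (i j).+1)
       diffop_mono (a * c j s) (fun l => if l == j then s : nat else i l).
  apply/funext => phi; rewrite /lie_op [RHS]/GRing.add /= [in RHS]/GRing.opp /=.
  rewrite fct_sumE.
  under [X in _ = _ - X]eq_bigr do rewrite fct_sumE.
  pose P l := iter (i l) (@der R M) (phi l).
  have E0 : lie w.2 X (diffop_mono a i phi) = diffop_mono (lie w.2 X a) i phi +
      X * (a * \sum_j \prod_l (if l == j then der (P l) else P l)).
    rewrite /lie /diffop_mono derM der_prod mulrDr mulrDl -scalerAl !mulrA -!addrA.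
    by congr (_ + _); rewrite addrC.
  have E j : diffop_mono a i
        (fun l => if l == j then lie (w.1 0 j) X (phi j) else phi l) =
      X * (a * \prod_l (if l == j then der (P l) else P l))
        + \sum_(s < (i j).+1) diffop_mono (a * c j s)
             (fun l => if l == j then s : nat else i l) phi.
    rewrite /diffop_mono (bigD1 j) //= eqxx cE.
    under eq_bigr => l /negPf lj do rewrite lj.
    rewrite mulrDl mulrDr; congr (_ + _).
      rewrite [in RHS](bigD1 j) //= eqxx -!mulrA [LHS]mulrCA.
      congr (_ * (_ * (_ * _))).
      by apply: eq_bigr => l /negPf ->.
    rewrite mulr_suml mulr_sumr; apply: eq_bigr => s _.
    rewrite [in RHS](bigD1 j) //= eqxx -!mulrA.
    congr (_ * (_ * _)); congr (_ * _).
    by apply: eq_bigr => l /negPf ->.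
  under eq_bigr do rewrite E.
  by rewrite E0 big_split /= -!mulr_sumr opprD addrA addrK.
apply/diffopP; rewrite rpredB //; first exact/diffopP/mono_diffop.
rewrite rpred_sum // => j _; rewrite rpred_sum // => s _.
apply/diffopP/mono_diffop; apply: leq_trans ik.
rewrite (bigD1 j) //= eqxx [leqRHS](bigD1 j) //= leq_add //.
  by rewrite -ltnS.
by rewrite leq_eqVlt; apply/orP; left; apply/eqP/eq_bigr => l /negPf ->.
Qed.

Lemma lie_op_diffop w X (A : diffop) : lie_op w X A \in diffop_pred.
Proof.
have /asboolP[a aE] := valP A.
have -> : A = \sum_(i : midx | (\sum_j i j <= k)%N)
    diffop_mono (a i) (fun j => i j) :> op.
  by apply/funext => phi; rewrite aE fct_sumE.
rewrite linear_sum rpred_sum // => i ik.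
exact/diffopP/lie_op_mono.
Qed.

(* D^k_{lambda; mu}, as a Vect(M)-module, is the space diffop with this
   action. *)
Definition act (w : weights) (X : C) (A : diffop) : diffop :=
  Diffop (lie_op_diffop w X A).

(* Isomorphism of abstract Vect(M)-modules: the linear bijection is not assumed
   to be local or continuous. *)
Definition isomorphic (w v : weights) : Prop :=
  exists T : {linear diffop -> diffop},
    bijective T /\ forall X A, T (act w X A) = act v X (T A).

End Operators.
End Modules.

Section Weights.
Variables (R : realType) (m : nat).
Implicit Types w v : weights R m.

(* mu - |lambda| *)
Definition weight_shift w : R := w.2 - \sum_j w.1 0 j.

(* the parameters (lambda_2, ..., lambda_m, 1 - mu; 1 - lambda_1) of the
   conjugate module; i1 stands for the first position (which exists if m >= 1),
   and ordS is the successor, used only below the last position *)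
Definition conj_weights (i1 : 'I_m) w : weights R m :=
  (\row_j (if (j.+1 < m)%N then w.1 0 (ordS j) else 1 - w.2), 1 - w.1 0 i1).

(* v arises from w by a (possibly empty) composition of permutations and
   conjugations *)
Inductive obtained w : weights R m -> Prop :=
| obtained_refl : obtained w w
| obtained_perm (i j : 'I_m) v :
    obtained w v -> obtained w (xcol i j v.1, v.2)
| obtained_conj (i1 : 'I_m) v :
    i1 = 0%N :> nat -> obtained w v -> obtained w (conj_weights i1 v).

(* Singularity of D^k_w.  The module itself is the case obtained_refl. *)
Definition singular (M : curve) (k : nat) w : Prop :=
  forall v, isomorphic M k w v -> obtained w v.

(* (0; delta), ((1 - delta) 1_1; 1), ..., ((1 - delta) 1_m; 1) *)
Definition exceptional (delta : R) w : Prop :=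
  w = (0, delta) \/ exists j : 'I_m, w = ((1 - delta) *: delta_mx 0 j, 1).

End Weights.

(* Main.v *)
Require Import Defs.
From HB Require Import structures.
From mathcomp Require Import all_boot all_order all_algebra perm.
From mathcomp Require Import all_classical all_reals all_analysis.
From mathcomp Require Import ring lra.
Set Implicit Arguments.
Unset Strict Implicit.
Unset Printing Implicit Defensive.
Import Order.TTheory GRing.Theory Num.Theory.
Import numFieldNormedType.Exports.
Local Open Scope ring_scope.

(* An operator of order at most 2 is given by its coefficients (a, b, c) of
   orders 2, 1, 0.  In these coordinates Vect(M) acts by the density actions of
   weights d - 2, d - 1, d (d the shift), up to lower triangular terms in X'' and
   X'''.  When d <> 1, 3/2, 2, adding multiples of derivatives of a and b to b
   and c removes all of them except a cocycle X''' from a to c, whose coefficient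
   vector Q depends quadratically on the weights.  Any two nonzero Q are
   exchanged by a linear automorphism of the a-space, and Q = 0 exactly for the
   exceptional weights.

   Conversely, an isomorphism with a module whose Q vanishes is not assumed to be
   local, but it preserves the kernel of L_1, which consists of the constant
   coefficients, and it commutes with every polynomial in the L_X.  The Casimir
   of span(1, cos x, sin x) and a cubic element, both commuting with L_1, act on
   this kernel: their joint eigenvalues recover the shift, and their commutator
   vanishes if and only if Q = 0. *)

(** * Cosine and sine as smooth functions on both curves *)

Section Trigonometric.
Variables (R : realType) (M : curve).
Local Notation C := (cinf R M).

Lemma derivable_cos_sin (a b x : R) :
  derivable (a *: (@cos R) + b *: (@sin R)) x 1.
Proof.
by apply: derivableD; apply: derivableZ; [exact: derivable_cos|exact: derivable_sin].
Qed.

Lemma derive1_cos_sin (a b : R) :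
  derive1 (a *: (@cos R) + b *: (@sin R)) = b *: (@cos R) + (- a) *: (@sin R).
Proof.
have dc := @derivable_cos R; have ds := @derivable_sin R.
rewrite der1D; [|by move=> x; exact: derivableZ|by move=> x; exact: derivableZ].
rewrite (der1Z _ dc) (der1Z _ ds).
have -> : derive1 (@cos R) = - (@sin R).
  by apply/funext => x; rewrite derive1E; case: (is_derive_cos x).
have -> : derive1 (@sin R) = @cos R.
  by apply/funext => x; rewrite derive1E; case: (is_derive_sin x).
by rewrite scalerN scaleNr addrC.
Qed.

(** The span of cos and sin is stable under differentiation, so the induction on the order runs over
    all its elements at once. *)
Lemma smooth_cos_sin (a b : R) : smooth M (a *: (@cos R) + b *: (@sin R)).
Proof.
split; last first.
  case: M => // x; rewrite /GRing.add /= /GRing.scale /=.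
  by congr (_ * _ + _ * _); [exact: cosD2pi|exact: sinD2pi].
apply/smooth_diff => n; elim: n a b => [|n IH] a b.
  by split=> [x|]; [exact: derivable_cos_sin|exact: I].
split; first by move=> x; exact: derivable_cos_sin.
by rewrite derive1_cos_sin; exact: IH.
Qed.

Lemma cos_smooth : @cos R \in @smooth_pred R M.
Proof.
by apply/asboolP; have := smooth_cos_sin 1 0; rewrite scale0r addr0 scale1r.
Qed.

Lemma sin_smooth : @sin R \in @smooth_pred R M.
Proof.
by apply/asboolP; have := smooth_cos_sin 0 1; rewrite scale0r add0r scale1r.
Qed.

Definition cosM : C := Cinf cos_smooth.
Definition sinM : C := Cinf sin_smooth.

Lemma der_cosM : der cosM = - sinM.
Proof.
apply/val_inj; transitivity (derive1 (1 *: (@cos R) + 0 *: (@sin R))).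
  by rewrite scale1r scale0r addr0.
by rewrite derive1_cos_sin scale0r add0r scaleN1r.
Qed.

Lemma der_sinM : der sinM = cosM.
Proof.
apply/val_inj; transitivity (derive1 (0 *: (@cos R) + 1 *: (@sin R))).
  by rewrite scale1r scale0r add0r.
by rewrite derive1_cos_sin oppr0 scale0r addr0 scale1r.
Qed.

Lemma cosM2_sinM2 : cosM * cosM + sinM * sinM = 1.
Proof.
by apply/val_inj/funext => x; have := cos2Dsin2 x; rewrite !expr2.
Qed.

Lemma der_alg (a : R) : der (a%:A : C) = 0.
Proof.
rewrite linearZ /=; suff -> : der 1 = 0 :> C by rewrite scaler0.
by apply/val_inj/funext => x; exact: derive1_cst.
Qed.

Lemma der1 : der 1 = 0 :> C.
Proof. by have := der_alg 1; rewrite scale1r. Qed.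

Lemma der_eq0 (f : C) : der f = 0 -> f = (f 0)%:A.
Proof.
move=> df; apply/val_inj/funext => x.
transitivity (f 0); last by exact: esym (mulr1 _).
apply: is_derive_0_is_cst => y.
have -> : (0 : R) = 'D_1 f y.
  by rewrite -derive1E; transitivity ((0 : C) y); [|rewrite -df].
by apply: derivableP; exact: cinf_derivable.
Qed.

Lemma alg_eq0 (a : R) : a%:A = 0 :> C -> a = 0.
Proof.
by move=> /(congr1 (fun f : C => f 0)) a0; rewrite -[LHS]mulr1; exact: a0.
Qed.

Lemma lieE lam (X a : C) : lie lam X a = X * der a + lam%:A * (der X * a).
Proof. by rewrite /lie mulr_algl. Qed.

End Trigonometric.
Arguments cosM {R M}.
Arguments sinM {R M}.

(** * Two elements of the enveloping algebra and their values on constants *)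

Section Words.
Variables (R : realType) (M : curve).
Local Notation C := (cinf R M).
Implicit Types (X a : C) (l r : R).

(** The double-angle functions, kept as polynomials in [cosM] and [sinM] for [ring]. *)
Definition cos2M : C := cosM * cosM - sinM * sinM.
Definition sin2M : C := sinM * cosM + sinM * cosM.

(* The Casimir element of the copy of sl_2 spanned by 1, cos x, sin x, up to the
   square of L_1; with L_k = L_{e^(ikx)}, the second one is
   (L_{-1}^2 L_2 - L_1^2 L_{-2}) / 2i. *)
Definition casimir (V : zmodType) (rho : C -> V -> V) (v : V) : V :=
  rho cosM (rho cosM v) + rho sinM (rho sinM v).
Definition cubic (V : zmodType) (rho : C -> V -> V) (v : V) : V :=
  (rho cosM (rho cosM (rho sin2M v)) - rho sinM (rho sinM (rho sin2M v))) -
  (rho cosM (rho sinM (rho cos2M v)) + rho sinM (rho cosM (rho cos2M v))).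

(** Constants are written as values of the ring morphism [GRing.in_alg C], which [ring] can
    normalize. *)
Lemma der_in_alg r : der (GRing.in_alg C r) = 0.
Proof. exact: der_alg. Qed.

Lemma derD (f g : C) : der (f + g) = der f + der g.
Proof. exact: linearD. Qed.

Lemma derN (f : C) : der (- f) = - der f.
Proof. exact: linearN. Qed.

Lemma der0 : der 0 = 0 :> C.
Proof. exact: linear0. Qed.

Lemma derZ r (f : C) : der (r *: f) = r *: der f.
Proof. exact: linearZ. Qed.

Lemma der_sum (I : finType) (f : I -> C) : der (\sum_i f i) = \sum_i der (f i).
Proof. exact: linear_sum. Qed.

Lemma scale_in_alg r (f : C) : r *: f = GRing.in_alg C r * f.
Proof. by rewrite in_algE mulr_algl. Qed.

Definition derE := (derD, derN, @derM R M, @der_cosM R M, @der_sinM R M,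
  der_in_alg, @der1 R M, der0).

(** Eigenvalues of the two elements on constants in the densities of weight l. *)
Definition casimir_wt l := l * l - l.
Definition cubic_wt l := casimir_wt l * (2 * (2 - l)).

Lemma casimir_lie l r : casimir (@lie R M l) r%:A = (casimir_wt l * r)%:A.
Proof.
rewrite /casimir !lieE /casimir_wt -!in_algE !derE.
(* The factor cos^2 + sin^2 = 1 turns the goal into a polynomial identity in independent [cosM] and
   [sinM]; the cubic element will need its square. *)
rewrite -[RHS]mul1r -(cosM2_sinM2 R M); ring.
Qed.

Lemma der_cos2M : der cos2M = - (sin2M + sin2M).
Proof. by rewrite /cos2M /sin2M !derE; ring. Qed.

Lemma der_sin2M : der sin2M = cos2M + cos2M.
Proof. by rewrite /cos2M /sin2M !derE; ring. Qed.

Definition derTE := (derE, der_cos2M, der_sin2M).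

Lemma cubic_lie l r : cubic (@lie R M l) r%:A = (cubic_wt l * r)%:A.
Proof.
rewrite /cubic !lieE /cubic_wt /casimir_wt -!in_algE !derTE.
transitivity ((cosM * cosM + sinM * sinM) * (cosM * cosM + sinM * sinM) *
  GRing.in_alg C ((l * l - l) * (2 * (2 - l)) * r)).
  by rewrite /cos2M /sin2M; ring.
by rewrite cosM2_sinM2 !mul1r.
Qed.

(* The extension of densities of weight d - 2 by densities of weight d with
   cocycle - q X'''. *)
Definition ext d q X (v : C * C) : C * C :=
  (lie (d - 2) X v.1, lie d X v.2 - q *: (der (der (der X)) * v.1)).

(** On pairs of constants both elements act by triangular matrices, whose corner entries are
    multiples of q and feed the commutator in [normal_form_obstruction]. *)
Lemma casimir_ext d q r t : casimir (ext d q) (r%:A, t%:A) =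
  ((casimir_wt (d - 2) * r)%:A, (casimir_wt d * t + (2 * d - 3) * q * r)%:A).
Proof.
congr (_, _); first exact: casimir_lie.
rewrite /casimir /ext /= !lieE !scale_in_alg !derTE.
transitivity ((cosM * cosM + sinM * sinM) *
  GRing.in_alg C (casimir_wt d * t + (2 * d - 3) * q * r)).
  by rewrite /casimir_wt; ring.
by rewrite cosM2_sinM2 mul1r in_algE -scale_in_alg.
Qed.

Lemma ext_sin2M d q r t : ext d q sin2M (r%:A, t%:A) =
  ((2 * (d - 2) * r) *: cos2M, (2 * (d * t) + 8 * (q * r)) *: cos2M).
Proof.
by congr (_, _); rewrite /= lieE -!in_algE !scale_in_alg !derTE; ring.
Qed.

Lemma ext_cos2M d q r t : ext d q cos2M (r%:A, t%:A) =
  ((- (2 * (d - 2) * r)) *: sin2M, (- (2 * (d * t) + 8 * (q * r))) *: sin2M).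
Proof.
by congr (_, _); rewrite /= lieE -!in_algE !scale_in_alg !derTE; ring.
Qed.

Lemma cubic_ext d q r t : cubic (ext d q) (r%:A, t%:A) =
  ((cubic_wt (d - 2) * r)%:A,
   (cubic_wt d * t - 6 * (d - 2) * (2 * d - 3) * q * r)%:A).
Proof.
congr (_, _); first exact: cubic_lie.
rewrite /cubic ext_sin2M ext_cos2M /ext /= !lieE -!in_algE !scale_in_alg !derTE.
set u := 2 * (d * t) + _; set v := 2 * (d - 2) * r.
transitivity ((cosM * cosM + sinM * sinM) * (cosM * cosM + sinM * sinM) *
  GRing.in_alg C ((d - 1) * (2 - d) * u + (5 - 2 * d) * (q * v))).
  by rewrite /cos2M /sin2M; move: u v => u v; ring.
rewrite cosM2_sinM2 !mul1r; congr (GRing.in_alg C _).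
by rewrite /u /v /cubic_wt /casimir_wt; ring.
Qed.

End Words.

(** * Module isomorphisms, and the derivative of the density action *)

Section Isomorphism.
Variables (R : realType) (M : curve).
Local Notation C := (cinf R M).

(** [isomorphic] is the case of operator spaces with [act]; arbitrary spaces let isomorphisms pass
    through coefficient models. *)
Definition module_iso (V W : lmodType R) (rV : C -> V -> V) (rW : C -> W -> W) :=
  exists T : {linear V -> W}, bijective T /\ forall X v, T (rV X v) = rW X (T v).

Lemma module_iso_linear (V W : lmodType R) (rV : C -> V -> V) (rW : C -> W -> W)
    (T : V -> W) : linear T -> bijective T ->
  (forall X v, T (rV X v) = rW X (T v)) -> module_iso rV rW.
Proof.
move=> Tl Tb TX.
pose TL := GRing.isLinear.Build R V W _ T Tl.
pose T' : {linear V -> W} := HB.pack T TL.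
by exists T'.
Qed.

Lemma module_iso_sym (V W : lmodType R) (rV : C -> V -> V) (rW : C -> W -> W) :
  module_iso rV rW -> module_iso rW rV.
Proof.
move=> [T [[S TK SK] TX]].
have Sl : linear S.
  by move=> a u v; apply: (can_inj TK); rewrite linearP !SK.
apply: (module_iso_linear Sl); first by exists T.
by move=> X v; apply: (can_inj TK); rewrite TX !SK.
Qed.

Lemma module_iso_trans (U V W : lmodType R) (rU : C -> U -> U) (rV : C -> V -> V)
  (rW : C -> W -> W) : module_iso rU rV -> module_iso rV rW -> module_iso rU rW.
Proof.
move=> [T [Tb TX]] [S [Sb SX]].
apply: (@module_iso_linear _ _ _ _ (S \o T)).
- by move=> a u v; rewrite /= !linearP.
- exact: bij_comp.
- by move=> X v; rewrite /= TX SX.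
Qed.

Lemma lieZ l r (X f : C) : lie l X (r *: f) = r *: lie l X f.
Proof. exact: linearZ. Qed.

Lemma lieD l (X f g : C) : lie l X (f + g) = lie l X f + lie l X g.
Proof. exact: linearD. Qed.

Lemma lie_sum l (X : C) (I : finType) (f : I -> C) :
  lie l X (\sum_i f i) = \sum_i lie l X (f i).
Proof. exact: linear_sum. Qed.

(** The derivative fails to intertwine the weights l and l + 1 by l X'' f; this defect cancels the
    X'' terms in [normalize]. *)
Lemma der_lie l (X f : C) :
  der (lie l X f) = lie (l + 1) X (der f) + l *: (der (der X) * f).
Proof.
rewrite !lieE -[l *: (_ * f)]mulr_algl -!in_algE !derE; ring.
Qed.

Lemma sum_der_linear (I : finType) (a : I -> R) r (f g : I -> C) :
  \sum_i a i *: der (r *: f i + g i) =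
  r *: (\sum_i a i *: der (f i)) + \sum_i a i *: der (g i).
Proof.
rewrite scaler_sumr -big_split; apply: eq_bigr => i _ /=.
by rewrite derD derZ scalerDr !scalerA [r * _]mulrC.
Qed.

Lemma sum_der2_linear (I : finType) (a : I -> R) r (f g : I -> C) :
  \sum_i a i *: der (der (r *: f i + g i)) =
  r *: (\sum_i a i *: der (der (f i))) + \sum_i a i *: der (der (g i)).
Proof. by rewrite -sum_der_linear; apply: eq_bigr => i _; rewrite derD derZ. Qed.

Lemma scaler_addACA (V : lmodType R) r (a b c d : V) :
  r *: a + b + (r *: c + d) = r *: (a + c) + (b + d).
Proof. by rewrite scalerDr addrACA. Qed.

Lemma sum_reassoc (V : zmodType) (I : finType) (c x y : V) (f1 f2 f3 f4 f5 : I -> V) :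
  (forall i, - f1 i - f2 i + f3 i = f4 i - f5 i) ->
  c - y - \sum_i f1 i + (x + y - \sum_i f2 i) + \sum_i f3 i =
  c + x + \sum_i f4 i - \sum_i f5 i.
Proof.
move=> E; rewrite -[RHS]addrA -sumrB -(eq_bigr _ (fun i _ => E i)) big_split /=.
rewrite sumrB sumrN; move: (\sum_i _) (\sum_i _) (\sum_i _) => u v w.
rewrite !addrA; do 2 congr (_ + _).
by rewrite -!addrA; congr (_ + _); rewrite (addrC x) addrCA addKr addrC.
Qed.

End Isomorphism.

(** * The coefficient model and its normal form *)

Section Model.
Variables (R : realType) (M : curve) (m : nat) (J : finType).
Local Notation C := (cinf R M).
Implicit Types (d : R) (K : J -> 'I_m -> R) (L : 'I_m -> R) (Q : J -> R).

(* The coefficients of the quadratic monomials, indexed by J, of the phi_j' and of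
   the product of the arguments. *)
Definition symbols : lmodType R := ((J -> C) * ('I_m -> C) * C)%type.

(** K and L carry X'' from order 2 to 1 and from 1 to 0, and Q carries X''' from 2 to 0. Since X''
    and X''' are cocycles with values in densities of weights 1 and 2, any values define an
    action. *)
Definition rho d K L Q (X : C) (v : symbols) : symbols :=
  (fun p => lie (d - 2) X (v.1.1 p),
   fun j => lie (d - 1) X (v.1.2 j) - \sum_p K p j *: (der (der X) * v.1.1 p),
   lie d X v.2 - \sum_j L j *: (der (der X) * v.1.2 j)
     - \sum_p Q p *: (der (der (der X)) * v.1.1 p)).

Lemma symbols_eq (u v : symbols) :
  (forall p, u.1.1 p = v.1.1 p) -> (forall j, u.1.2 j = v.1.2 j) ->
  u.2 = v.2 -> u = v.
Proof.
move: u v => [[a b] c] [[a' b'] c'] /= ea eb ->.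
by congr (_, _, _); apply/funext.
Qed.

(* The coefficients cancel, in this order, the X'' terms from a to b and from b to
   c, and the X'' a' term from a to c that the latter cancellation creates. *)
Definition normalize d K L (v : symbols) : symbols :=
  (v.1.1,
   fun j => v.1.2 j + \sum_p ((d - 2)^-1 * K p j) *: der (v.1.1 p),
   v.2 + \sum_j ((d - 1)^-1 * L j) *: der (v.1.2 j)
     + \sum_p ((d - 1)^-1 * (\sum_j L j * K p j) / (2 * d - 3)) *:
          der (der (v.1.1 p))).

Lemma normalize_linear d K L : linear (normalize d K L).
Proof.
pose Sb (b : 'I_m -> C) := \sum_j ((d - 1)^-1 * L j) *: der (b j).
pose Sa (a : J -> C) :=
  \sum_p ((d - 1)^-1 * (\sum_j L j * K p j) / (2 * d - 3)) *: der (der (a p)).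
move=> r [[a b] c] [[a' b'] c']; apply: symbols_eq => [p|j|]; rewrite [LHS]/=.
- by [].
- by rewrite sum_der_linear; exact: scaler_addACA.
- transitivity (r *: c + c' + (r *: Sb b + Sb b') + (r *: Sa a + Sa a')).
    by congr (_ + _ + _); [exact: sum_der_linear|exact: sum_der2_linear].
  by rewrite !scaler_addACA.
Qed.

(** By [der_lie] at weight d - 2 the added derivative contributes (d - 2) X'' a, hence the factor 1
    / (d - 2). The condition on d is stated under [J] so that operators of order 1, which have no a,
    exclude only d = 1. *)
Lemma normalize_first d K X (a : J -> C) (b : C) j :
  (J -> d <> 2) ->
  lie (d - 1) X b - \sum_p K p j *: (der (der X) * a p) +
    \sum_p ((d - 2)^-1 * K p j) *: der (lie (d - 2) X (a p)) =
  lie (d - 1) X (b + \sum_p ((d - 2)^-1 * K p j) *: der (a p)) -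
    \sum_p 0 *: (der (der X) * a p).
Proof.
move=> d2; rewrite [X in _ = _ - X]big1 => [|p _]; last by rewrite scale0r.
rewrite subr0 lieD lie_sum -addrA; congr (_ + _).
rewrite -sumrN -big_split; apply: eq_bigr => p _ /=.
have /eqP d2' : d - 2 != 0 by rewrite subr_eq0; exact/eqP/d2.
rewrite der_lie lieZ scalerDr scalerA mulrAC mulVf ?mul1r; last exact/eqP.
have -> : d - 2 + 1 = d - 1 by ring.
exact: etrans (addrC _ _) (addrK _ _).
Qed.

(** Let S be the sum of L j * K p j. Cancelling L X'' b creates - S / (d - 1) (X'' a)'. The second
    derivative of a contributes (2 d - 3) X'' a' + (d - 2) X''' a; with coefficient S / ((d - 1) (2
    d - 3)) it removes X'' a' and leaves - S / (2 d - 3) X''' a. *)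
Lemma normalize_zeroth d K L Q X (a : J -> C) (b : 'I_m -> C) (c : C) :
  d <> 1 -> (J -> 2 * d <> 3) ->
  lie d X c - \sum_j L j *: (der (der X) * b j) -
    \sum_p Q p *: (der (der (der X)) * a p) +
    \sum_j ((d - 1)^-1 * L j) *:
      der (lie (d - 1) X (b j) - \sum_p K p j *: (der (der X) * a p)) +
    \sum_p ((d - 1)^-1 * (\sum_j L j * K p j) / (2 * d - 3)) *:
      der (der (lie (d - 2) X (a p))) =
  lie d X (c + \sum_j ((d - 1)^-1 * L j) *: der (b j) +
     \sum_p ((d - 1)^-1 * (\sum_j L j * K p j) / (2 * d - 3)) *: der (der (a p))) -
    \sum_j 0 *: (der (der X) * (b j + \sum_p ((d - 2)^-1 * K p j) *: der (a p)))
   - \sum_p (Q p + (\sum_j L j * K p j) / (2 * d - 3)) *: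
       (der (der (der X)) * a p).
Proof.
move=> d1 d3; rewrite [X in _ = _ - X - _]big1 => [|p _]; last by rewrite scale0r.
have {}d1 : d - 1 != 0 by rewrite subr_eq0; exact/eqP.
rewrite subr0 !lieD !lie_sum.
have -> : \sum_j ((d - 1)^-1 * L j) *:
      der (lie (d - 1) X (b j) - \sum_p K p j *: (der (der X) * a p)) =
    \sum_j (((d - 1)^-1 * L j) *: lie d X (der (b j)) +
      L j *: (der (der X) * b j)) -
    \sum_p ((d - 1)^-1 * \sum_j L j * K p j) *: der (der (der X) * a p).
  under [X in _ = _ - X]eq_bigr do rewrite mulr_sumr scaler_suml.
  rewrite exchange_big -sumrB; apply: eq_bigr => j _ /=.
  rewrite derD derN der_sum scalerBr der_lie subrK scalerDr; congr (_ + _ - _).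
    by rewrite scalerA mulrAC mulVf // mul1r.
  rewrite scaler_sumr; apply: eq_bigr => p _.
  by rewrite derZ scalerA mulrA.
rewrite big_split /=.
pose B := \sum_j ((d - 1)^-1 * L j) *: lie d X (der (b j)).
pose B' := \sum_j L j *: (der (der X) * b j).
pose V p := (d - 1)^-1 * (\sum_j L j * K p j) / (2 * d - 3).
have E p : - (Q p *: (der (der (der X)) * a p)) -
    ((d - 1)^-1 * \sum_j L j * K p j) *: der (der (der X) * a p) +
    V p *: der (der (lie (d - 2) X (a p))) =
    lie d X (V p *: der (der (a p))) - (Q p +
      (\sum_j L j * K p j) / (2 * d - 3)) *: (der (der (der X)) * a p).
  have {}d3 : 2 * d - 3 != 0 by rewrite subr_eq0; exact/eqP/d3.
  (* Expressing both fractions through [V p] leaves a goal free of divisions. *)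
  have -> : (d - 1)^-1 * (\sum_j L j * K p j) = V p * (2 * d - 3).
    by rewrite /V mulfVK.
  have -> : (\sum_j L j * K p j) / (2 * d - 3) = V p * (d - 1).
    by rewrite /V [RHS]mulrC !mulrA mulfV // mul1r.
  have d21 : d - 2 + 1 + 1 = d by ring.
  rewrite !der_lie derD der_lie d21 lieZ derZ.
  move: (V p) (a p) (Q p) => v f q.
  have e : d = (d - 2) + 2 by ring.
  rewrite e; move: (d - 2) => {}e.
  rewrite !derM; move: (der (der (der X))) (der (der X)) (der f) => X3 X2 f1.
  by rewrite !scale_in_alg; ring.
have -> : \sum_j lie d X (((d - 1)^-1 * L j) *: der (b j)) = B.
  by apply: eq_bigr => j _; exact: lieZ.
exact: sum_reassoc E.
Qed.

Lemma rho_normal d K L Q : d <> 1 -> (J -> d <> 2 /\ 2 * d <> 3) ->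
  module_iso (rho d K L Q)
    (rho d (fun _ _ => 0) (fun=> 0)
       (fun p => Q p + (\sum_j L j * K p j) / (2 * d - 3))).
Proof.
move=> d1 d23; apply: (module_iso_linear (T := normalize d K L)).
- exact: normalize_linear.
(* The order 0 correction uses the original b, so the inverse recovers b before c. *)
- exists (fun v : symbols =>
    let b j := v.1.2 j - \sum_p ((d - 2)^-1 * K p j) *: der (v.1.1 p) in
    (v.1.1, b, v.2 - \sum_p ((d - 1)^-1 * (\sum_j L j * K p j) / (2 * d - 3)) *:
          der (der (v.1.1 p)) - \sum_j ((d - 1)^-1 * L j) *: der (b j))
    : symbols).
  + by move=> v; apply: symbols_eq => [p|j|] //=; rewrite ?addrK //;
      under [X in _ - X]eq_bigr do rewrite addrK; rewrite !addrK.
  + by move=> v; apply: symbols_eq => [p|j|] //=; rewrite ?addrNK // !subrK.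
move=> X [[a b] c]; apply: symbols_eq => [p|j|]; rewrite ?[LHS]/= ?[RHS]/=.
- by [].
- by apply: normalize_first => p; case: (d23 p).
- by apply: normalize_zeroth => // p; case: (d23 p).
Qed.

End Model.

(** * Normal forms with different nonzero cocycles *)

Section Pivot.
Variables (R : realType) (M : curve) (m : nat) (J : finType).
Local Notation C := (cinf R M).
Implicit Types (d : R) (Q : J -> R).

Definition normal_form d Q : C -> symbols R M m J -> symbols R M m J :=
  rho d (fun _ _ => 0) (fun=> 0) Q.

Lemma normal_formE d Q X v : normal_form d Q X v =
  (fun p => lie (d - 2) X (v.1.1 p), fun j => lie (d - 1) X (v.1.2 j),
   lie d X v.2 - \sum_p Q p *: (der (der (der X)) * v.1.1 p)).
Proof.
apply: symbols_eq => [p|j|] //=.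
  by rewrite big1 ?subr0 // => p _; rewrite scale0r.
by rewrite [X in _ - X - _]big1 ?subr0 // => j _; rewrite scale0r.
Qed.

Lemma sum_indicator (u : J) (f : J -> C) : \sum_p (p == u)%:R *: f p = f u.
Proof.
rewrite (bigD1 u) //= eqxx scale1r big1 ?addr0 // => p /negPf ->.
by rewrite scale0r.
Qed.

(** All second-order coefficients carry the same density action, so constant invertible matrices may
    mix them. The combination multiplying X''' becomes the new coordinate [p0]; this is invertible
    because [Q p0] is nonzero. *)
Lemma normal_form_pivot d Q p0 : Q p0 <> 0 ->
  module_iso (normal_form d Q) (normal_form d (fun p => (p == p0)%:R)).
Proof.
move=> /eqP Q0.
pose S (v : symbols R M m J) : symbols R M m J :=
  ((fun p => if p == p0 then \sum_q Q q *: v.1.1 q else v.1.1 p), v.1.2, v.2).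
apply: (module_iso_linear (T := S)).
- move=> r [[a b] c] [[a' b'] c']; apply: symbols_eq => [p|j|] //.
  change ((if p == p0 then \sum_q Q q *: (r *: a q + a' q) else r *: a p + a' p) =
    r *: (if p == p0 then \sum_q Q q *: a q else a p) +
      (if p == p0 then \sum_q Q q *: a' q else a' p)).
  case: ifP => // _; rewrite scaler_sumr -big_split; apply: eq_bigr => q _ /=.
  by rewrite scalerDr !scalerA [r * _]mulrC.
- exists (fun v : symbols R M m J =>
    ((fun p => if p == p0 then
       (Q p0)^-1 *: (v.1.1 p0 - \sum_(q | q != p0) Q q *: v.1.1 q) else v.1.1 p),
     v.1.2, v.2) : symbols R M m J).
  + move=> [[a b] c]; apply: symbols_eq => [p|j|] //=.
    case: eqP => [->|//]; rewrite eqxx (bigD1 p0) //=.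
    under [X in _ - X]eq_bigr => q /negPf q0 do rewrite q0.
    by rewrite addrK scalerA mulVf // scale1r.
  + move=> [[a b] c]; apply: symbols_eq => [p|j|] //=.
    case: eqP => [->|//]; rewrite (bigD1 p0) //= eqxx.
    under [X in _ + X]eq_bigr => q /negPf q0 do rewrite q0.
    by rewrite scalerA mulfV // scale1r subrK.
move=> X [[a b] c]; rewrite !normal_formE; apply: symbols_eq => [p|j|] //=.
  case: ifP => // _; rewrite lie_sum; apply: eq_bigr => q _.
  by rewrite lieZ.
rewrite sum_indicator eqxx mulr_sumr; congr (_ - _).
by apply: eq_bigr => q _; rewrite scalerAr.
Qed.

Lemma normal_form_swap d p0 q0 :
  module_iso (normal_form d (fun p => (p == p0)%:R))
    (normal_form d (fun p => (p == q0)%:R)).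
Proof.
pose S (v : symbols R M m J) : symbols R M m J :=
  (v.1.1 \o tperm p0 q0, v.1.2, v.2).
have SK : involutive S.
  by move=> [[a b] c]; apply: symbols_eq => [p|j|] //=; rewrite tpermK.
apply: (module_iso_linear (T := S)).
- by move=> r [[a b] c] [[a' b'] c']; apply: symbols_eq.
- by exists S.
move=> X [[a b] c]; rewrite !normal_formE; apply: symbols_eq => [p|j|] //=.
by rewrite !sum_indicator /= tpermR.
Qed.

Lemma normal_form_iso d Q Q' p0 q0 : Q p0 <> 0 -> Q' q0 <> 0 ->
  module_iso (normal_form d Q) (normal_form d Q').
Proof.
move=> Qp Qq.
exact: module_iso_trans (normal_form_pivot d Qp)
  (module_iso_trans (normal_form_swap d p0 q0)
     (module_iso_sym (normal_form_pivot d Qq))).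
Qed.

End Pivot.

(** * Transport of the two elements along equivariant maps *)

Section Intertwining.
Variables (R : realType) (M : curve) (V W : zmodType).
Local Notation C := (cinf R M).
Variables (rV : C -> V -> V) (rW : C -> W -> W) (P : V -> Prop) (phi : V -> W).
Hypothesis phiD : forall u v, phi (u + v) = phi u + phi v.
Hypothesis phiB : forall u v, phi (u - v) = phi u - phi v.
Hypothesis rVP : forall X v, P v -> P (rV X v).
Hypothesis phi_rV : forall X v, P v -> phi (rV X v) = rW X (phi v).

(** Equivariance is asked only on a stable subset [P]: a lower-order component is equivariant only
    where the higher ones vanish. *)
Lemma casimir_intertwine v : P v -> phi (casimir rV v) = casimir rW (phi v).
Proof. by move=> Pv; rewrite /casimir phiD !phi_rV //; do !apply: rVP. Qed.

Lemma cubic_intertwine v : P v -> phi (cubic rV v) = cubic rW (phi v).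
Proof.
by move=> Pv; rewrite /cubic !phiB phiD !phi_rV //; do !apply: rVP.
Qed.

End Intertwining.

(** * What an abstract, possibly nonlocal isomorphism preserves *)

Section Rigidity.
Variables (R : realType) (M : curve) (m : nat) (J : finType).
Local Notation C := (cinf R M).
Local Notation V := (symbols R M m J).
Implicit Types (d e : R) (K : J -> 'I_m -> R) (L : 'I_m -> R) (Q : J -> R).

Lemma lie1 l (f : C) : lie l 1 f = der f.
Proof. by rewrite lieE der1 mul0r mulr0 addr0 mul1r. Qed.

(** Equal Casimir values force l = l' or l + l' = 1. The cubic value is the Casimir value times 2 (2
    - l), so it separates l from 1 - l unless the Casimir value is zero, which leaves the pair 0,
    1. *)
Lemma weight_eq (l l' : R) : casimir_wt l = casimir_wt l' ->
  cubic_wt l = cubic_wt l' -> [\/ l = l', l = 0 /\ l' = 1 | l = 1 /\ l' = 0].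
Proof.
rewrite /cubic_wt /casimir_wt => e1; rewrite e1 => e2.
have [->|ll] := eqVneq l l'; first by constructor 1.
have ll1 : l + l' = 1.
  have : (l - l') * (l + l' - 1) = 0.
    by transitivity (l * l - l - (l' * l' - l')); [ring|rewrite e1 subrr].
  by move/eqP; rewrite mulf_eq0 subr_eq0 (negPf ll) /= subr_eq0 => /eqP.
have /eqP : l' * (l' - 1) * (l - l') = 0.
  transitivity (((l' * l' - l') * (2 * (2 - l')) - (l' * l' - l') * (2 * (2 - l))) / 2).
    by field.
  by rewrite e2 subrr mul0r.
rewrite !mulf_eq0 [l - l' == 0]subr_eq0 (negPf ll) orbF => /orP[] /eqP l0.
  by constructor 3; split=> //; lra.
by constructor 2; split; lra.
Qed.

Definition joint_eigenvector (U : lmodType R) (r : C -> U -> U) (l : R) (u : U) :=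
  [/\ u <> 0, r 1 u = 0, casimir r u = casimir_wt l *: u &
      cubic r u = cubic_wt l *: u].

(** L_1 acts on densities as d/dx, so [phi u] is a nonzero constant, on which both elements act by
    known scalars. *)
Lemma leading_weight (U : lmodType R) (r : C -> U -> U) (P : U -> Prop)
    (phi : U -> C) (l l' : R) (u : U) :
  (forall u v, phi (u + v) = phi u + phi v) ->
  (forall u v, phi (u - v) = phi u - phi v) ->
  (forall a u, phi (a *: u) = a *: phi u) ->
  (forall X u, P u -> P (r X u)) ->
  (forall X u, P u -> phi (r X u) = lie l X (phi u)) ->
  P u -> phi u <> 0 -> joint_eigenvector r l' u ->
  casimir_wt l = casimir_wt l' /\ cubic_wt l = cubic_wt l'.
Proof.
move=> phiD phiB phiZ rP phir Pu u0 [_ r1 cas cub].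
have phi0 : phi 0 = 0 by rewrite -(subrr u) phiB subrr.
have /der_eq0 e : der (phi u) = 0 by rewrite -(lie1 l) -phir // r1 phi0.
move: (phi u 0) e => a e.
have a0 : a != 0.
  by apply/eqP => a0; apply: u0; rewrite e a0 scale0r.
have alg_inj (x y : R) : (x%:A : C) = y%:A -> x = y.
  by move=> /eqP; rewrite -subr_eq0 -scalerBl => /eqP/alg_eq0/eqP;
    rewrite subr_eq0 => /eqP.
split; apply: (mulIf a0); apply: alg_inj.
  by rewrite -casimir_lie -e -(casimir_intertwine phiD rP phir Pu) cas phiZ e scalerA.
by rewrite -cubic_lie -e -(cubic_intertwine phiD phiB rP phir Pu) cub phiZ e scalerA.
Qed.

(* The leading nonzero component of a joint eigenvector, of order i, is an
   eigenvector in the densities of weight e - i. *)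
Lemma eigenvector_weight e K L Q l (u : V) :
  joint_eigenvector (rho e K L Q) l u ->
  exists2 i : 'I_3, (casimir_wt (e - i%:R) = casimir_wt l /\
                    cubic_wt (e - i%:R) = cubic_wt l) &
    i = ord0 -> u.1.1 = 0 /\ u.1.2 = 0.
Proof.
move=> ju; have [u0 _ _ _] := ju.
have [a0|/eqP a0] := eqVneq u.1.1 0; last first.
  have [p ap] : exists p, u.1.1 p <> 0.
    by apply/not_existsP => H; apply: a0; apply/funext => p; apply: contrapT => /H.
  exists ord_max => //.
  by apply: (leading_weight (P := fun=> True) (phi := fun u : V => u.1.1 p)
    _ _ _ _ _ _ ap ju).
have [b0|/eqP b0] := eqVneq u.1.2 0; last first.
  have [j bj] : exists j, u.1.2 j <> 0.
    by apply/not_existsP => H; apply: b0; apply/funext => p; apply: contrapT => /H.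
  exists 1 => //.
  apply: (leading_weight (P := fun u : V => u.1.1 = 0) (phi := fun u : V => u.1.2 j)
    _ _ _ _ _ _ bj ju) => //.
  - by move=> X v /= ->; apply/funext => p; exact: linear0.
  - move=> X v /= ->; rewrite big1 ?subr0 // => p _.
    by rewrite mulr0 scaler0.
exists ord0 => //; rewrite subr0.
apply: (leading_weight (P := fun u : V => u.1.1 = 0 /\ u.1.2 = 0)
  (phi := fun u : V => u.2) _ _ _ _ _ _ _ ju) => //.
- move=> X v /= [-> ->]; split; apply/funext => p; first exact: linear0.
  by rewrite linear0 big1 ?subr0 // => q _; rewrite mulr0 scaler0.
- move=> X v /= [-> ->]; rewrite !big1 ?subr0 // => q _;
  by rewrite mulr0 scaler0.
- by move=> c0; apply: u0; apply: symbols_eq => [p|j|] //; rewrite ?a0 ?b0 ?c0.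
Qed.

Lemma eigenvector_iso (U U' : lmodType R) (r : C -> U -> U) (r' : C -> U' -> U')
    (T : {linear U -> U'}) l u :
  bijective T -> (forall X v, T (r X v) = r' X (T v)) ->
  joint_eigenvector r l u -> joint_eigenvector r' l (T u).
Proof.
move=> Tb Tr [u0 r1 cas cub].
have TD (x y : U) : T (x + y) = T x + T y := linearD T x y.
have TB (x y : U) : T (x - y) = T x - T y := linearB T x y.
have PT (X : C) (v : U) : True -> True by [].
have Tr' X v : True -> T (r X v) = r' X (T v) by [].
split.
- by move=> /eqP; rewrite -(linear0 T) (inj_eq (bij_inj Tb)) => /eqP.
- by rewrite -Tr r1 linear0.
- by rewrite -(casimir_intertwine TD PT Tr' I) cas linearZ.
- by rewrite -(cubic_intertwine TD TB PT Tr' I) cub linearZ.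
Qed.

(** The order 0 part is a submodule isomorphic to the densities of weight e, and this vector is its
    constant 1. *)
Lemma bottom_eigenvector e K L Q : joint_eigenvector (rho e K L Q) e ((0, 0, 1) : V).
Proof.
have e0 : (1 : C) = 1%:A by rewrite scale1r.
have rhoE X c : rho e K L Q X (0, 0, c) = (0, 0, lie e X c) :> V.
  apply: symbols_eq => [p|j|] /=; first exact: linear0.
    by rewrite linear0 big1 ?subr0 // => p _; rewrite mulr0 scaler0.
  by rewrite !big1 ?subr0 // => p _; rewrite mulr0 scaler0.
pose inc (c : C) : V := (0, 0, c).
have incD x y : inc (x + y) = inc x + inc y.
  by apply: symbols_eq => [p|j|] //=; rewrite addr0.
have incB x y : inc (x - y) = inc x - inc y.
  by apply: symbols_eq => [p|j|] //=; rewrite subr0.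
have incZ a x : inc (a *: x) = a *: inc x.
  by apply: symbols_eq => [p|j|] //=; rewrite scaler0.
have PT (X c : C) : True -> True by [].
have incr X c : True -> inc (lie e X c) = rho e K L Q X (inc c).
  by move=> _; exact: esym (rhoE X c).
split.
- by move=> /(congr1 snd)/eqP; rewrite oner_eq0.
- by rewrite rhoE lie1 der1.
- rewrite -[LHS](casimir_intertwine incD PT incr I) e0 casimir_lie -incZ.
  by rewrite scalerA.
- rewrite -[LHS](cubic_intertwine incD incB PT incr I) e0 cubic_lie -incZ.
  by rewrite scalerA.
Qed.

(** The bottom vectors are followed through the isomorphism and its inverse: up to confusing the
    weights 0 and 1, d is among e, e - 1, e - 2 and e is among d, d - 1, d - 2. *)
Lemma normal_form_shift d e K L Q : d <> 1 ->
  module_iso (normal_form (M := M) (m := m) d (fun _ : J => 0)) (rho e K L Q) -> e = d.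
Proof.
move=> d1 di; have [T [Tb TX]] := di; have [S [Sb SX]] := module_iso_sym di.
have := eigenvector_iso Tb TX (bottom_eigenvector d _ _ _).
move=> /eigenvector_weight[i [/weight_eq wi /wi {}wi] _].
have ju := eigenvector_iso Sb SX (bottom_eigenvector e K L Q).
have [j [/weight_eq wj /wj {}wj] j0] := eigenvector_weight ju.
(* The eigenvalues leave only e = d and the confusion of 0 with 1, of which d = 1 is excluded by
   hypothesis. *)
have [//|[d0 e1]] : e = d \/ d = 0 /\ e = 1.
  have ord3 (h : 'I_3) : [\/ h%:R = 0 :> R, h%:R = 1 :> R | h%:R = 2 :> R].
    case: h => [[|[|[|h]]] h3] //=; by [constructor 1|constructor 2|constructor 3].
  case: wi => [wi|[_ /d1//]|[wi d0]]; case: wj => [wj|[wj1 wj2]|[wj1 wj2]];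
    case: (ord3 i) => i3; case: (ord3 j) => j3;
    by [left; lra|right; split; lra|exfalso; apply: d1; lra].
have jE : j = ord0.
  apply/val_inj; case: j wj {j0} => [[|j] jlt] //= wj; exfalso.
  have : 0 <= j%:R :> R by rewrite ler0n.
  by move: wj; rewrite d0 e1 -natr1 => -[?|[? ?]|[? ?]] ?; lra.
(* The order 0 vector of weight 1 would be the image of a constant of weight 0,
   hence invariant under all vector fields. *)
have [a0 b0] := j0 jE; have [_ inv1 _ _] := ju.
move: (S (0, 0, 1)) a0 b0 inv1 (SX sinM (0, 0, 1)) => u a0 b0 inv1 inv.
have bottomE X (v : V) : (normal_form d (fun=> 0) X v).2 = lie d X v.2.
  by rewrite normal_formE /= big1 ?subr0 // => p _; rewrite scale0r.
have du : der u.2 = 0 by rewrite -(lie1 d) -bottomE inv1.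
have u0 : normal_form d (fun=> 0) sinM u = 0.
  apply: symbols_eq => [p|k|]; last first.
  - by rewrite bottomE lieE du d0 scale0r mulr0 mul0r addr0.
  - by rewrite normal_formE /= b0; exact: linear0.
  - by rewrite normal_formE /= a0; exact: linear0.
have : (rho e K L Q sinM (0, 0, 1) : V) = 0.
  by apply: (bij_inj Sb); rewrite inv u0 linear0.
move=> /(congr1 snd) /=; rewrite big1 ?subr0; last first.
  by move=> k _; rewrite mulr0 scaler0.
rewrite big1 ?subr0; last by move=> p _; rewrite mulr0 scaler0.
(* In weight 1, L_sin sends the constant 1 to cos x, which is nonzero at 0. *)
rewrite lieE e1 der1 mulr0 add0r scale1r mul1r mulr1 der_sinM.
move=> /(congr1 (fun f : C => f 0)) /=; rewrite cos0 => /eqP.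
by rewrite oner_eq0.
Qed.

(** With Q = 0 the module is a direct sum of densities, so the two elements commute on the kernel of
    L_1. The isomorphism carries this to the target, where the commutator has corner entry -12 (d -
    1) (d - 2) (2 d - 3) Q p. *)
Lemma normal_form_obstruction d Q : d <> 1 -> d <> 2 -> 2 * d <> 3 ->
  module_iso (normal_form (M := M) (m := m) d (fun _ : J => 0))
    (normal_form (m := m) d Q) ->
  forall p, Q p = 0.
Proof.
move=> d1 d2 d3 [T [Tb TX]] p.
have comm0 (v : V) : normal_form d (fun=> 0) 1 v = 0 ->
    casimir (normal_form d (fun=> 0)) (cubic (normal_form d (fun=> 0)) v) =
    cubic (normal_form d (fun=> 0)) (casimir (normal_form d (fun=> 0)) v).
  set r := normal_form _ _ => v1.
  (* An equivariant projection to densities sends v to a constant, a common eigenvector of both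
     elements. *)
  have comm (phi : V -> C) l :
      (forall u v, phi (u + v) = phi u + phi v) ->
      (forall u v, phi (u - v) = phi u - phi v) ->
      (forall X u, phi (r X u) = lie l X (phi u)) ->
      phi (casimir r (cubic r v)) = phi (cubic r (casimir r v)).
    move=> phiD phiB phir.
    have phi0 : phi 0 = 0 by rewrite -(subrr v) phiB subrr.
    have /der_eq0 e : der (phi v) = 0 by rewrite -(lie1 l) -phir v1 phi0.
    have PT (X : C) (u : V) : True -> True by [].
    have Tr X u : True -> phi (r X u) = lie l X (phi u) by [].
    have cas u := casimir_intertwine phiD PT Tr (v := u) I.
    have cub u := cubic_intertwine phiD phiB PT Tr (v := u) I.
    move: (phi v 0) e => a e.
    transitivity ((casimir_wt l * (cubic_wt l * a))%:A : C).
      by rewrite cas cub e cubic_lie casimir_lie.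
    rewrite cub cas e casimir_lie cubic_lie.
    by congr (_ *: _); ring.
  apply: symbols_eq => [q|j|].
  - by apply: (comm (fun u => u.1.1 q) (d - 2)) => // X u; rewrite /r normal_formE.
  - by apply: (comm (fun u => u.1.2 j) (d - 1)) => // X u; rewrite /r normal_formE.
  - apply: (comm snd d) => // X u; rewrite /r normal_formE /= big1 ?subr0 // => q _.
    by rewrite scale0r.
(* In the other module, the commutator maps the p-th constant to a multiple of
   Q p in order 0. *)
pose F (x : C * C) : V := ((fun q => if q == p then x.1 else 0), 0, x.2).
have FD x y : F (x + y) = F x + F y.
  apply: symbols_eq => [q|j|] //; last by change (0 = 0 + 0 :> C); rewrite addr0.
  change ((if q == p then x.1 + y.1 else 0) =
    (if q == p then x.1 else 0) + (if q == p then y.1 else 0)).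
  by case: ifP => // _; rewrite addr0.
have FB x y : F (x - y) = F x - F y.
  apply: symbols_eq => [q|j|] //; last by change (0 = 0 - 0 :> C); rewrite subr0.
  change ((if q == p then x.1 - y.1 else 0) =
    (if q == p then x.1 else 0) - (if q == p then y.1 else 0)).
  by case: ifP => // _; rewrite subr0.
have Fr X x : True -> F (ext d (Q p) X x) = normal_form d Q X (F x).
  move=> _; rewrite normal_formE; apply: symbols_eq => [q|j|] /=.
  - by case: ifP => // _; rewrite linear0.
  - by rewrite linear0.
  rewrite (bigD1 p) //= eqxx big1 ?addr0 // => q /negPf ->.
  by rewrite mulr0 scaler0.
have PT (X : C) (x : C * C) : True -> True by [].
have casF x := casimir_intertwine FD PT Fr (v := x) I.
have cubF x := cubic_intertwine FD FB PT Fr (v := x) I.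
have TD (x y : V) : T (x + y) = T x + T y := linearD T x y.
have TB (x y : V) : T (x - y) = T x - T y := linearB T x y.
have PV (X : C) (v : V) : True -> True by [].
have Tr X v : True -> T (normal_form d (fun=> 0) X v) = normal_form d Q X (T v) by [].
have casT v := casimir_intertwine TD PV Tr (v := v) I.
have cubT v := cubic_intertwine TD TB PV Tr (v := v) I.
have [S TK SK] := Tb.
have : F (casimir (ext d (Q p)) (cubic (ext d (Q p)) (1%:A, 0%:A))) =
       F (cubic (ext d (Q p)) (casimir (ext d (Q p)) (1%:A, 0%:A))).
  rewrite casF !cubF casF -[F (1%:A, _)]SK -cubT -casT -casT -cubT; congr (T _).
  (* The preimage of [F (1, 0)] lies in the kernel of L_1 because [F (1, 0)] has constant entries
     and T is equivariant. *)
  apply: comm0; apply: (can_inj TK); rewrite TX SK -Fr // linear0.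
  apply: symbols_eq => [q|j|] //=; rewrite ?lie1 ?der_alg ?if_same //.
  by rewrite der1 !der0 mul0r scaler0 subrr.
rewrite cubic_ext !casimir_ext cubic_ext => /(congr1 snd) /= /eqP.
rewrite -subr_eq0 -scalerBl => /eqP/alg_eq0 E.
have {}E : Q p * (12 * (d - 1) * (d - 2) * (2 * d - 3)) = 0.
  by rewrite -[RHS]oppr0 -E /cubic_wt /casimir_wt; ring.
have /eqP d10 : d - 1 <> 0 by move=> /subr0_eq/d1.
have /eqP d20 : d - 2 <> 0 by move=> /subr0_eq/d2.
have /eqP d30 : 2 * d - 3 <> 0 by move=> /subr0_eq/d3.
move/eqP: E; rewrite !mulf_eq0 (negPf d10) (negPf d20) (negPf d30) !orbF.
by rewrite pnatr_eq0 orbF => /eqP.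
Qed.

End Rigidity.

(** * The action on monomial operators of order at most two *)

Section Monomials.
Variables (R : realType) (M : curve) (m : nat).
Local Notation C := (cinf R M).
Implicit Types (a X : C) (i : 'I_m -> nat) (w : weights R m).

(** Leibniz rule, with [n == 2] standing for the binomial coefficient of n over 2. Where a
    predecessor truncates, its coefficient is zero. *)
Lemma iter_der_lie l X (f : C) n : (n <= 2)%N ->
  iter n (@der R M) (lie l X f) =
  X * iter n.+1 (@der R M) f + (n%:R + l) *: (der X * iter n (@der R M) f) +
  ((n == 2)%:R + n%:R * l) *: (der (der X) * iter n.-1 (@der R M) f) +
  ((n == 2)%:R * l) *: (der (der (der X)) * iter n.-2 (@der R M) f).
Proof.
case: n => [|[|[|//]]] _ /=.
- by rewrite /lie add0r !mul0r addr0 !scale0r !addr0.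
- rewrite !lieE !scale_in_alg !derE; ring.
- rewrite !lieE !scale_in_alg !derE; ring.
Qed.

Definition lower i (j : 'I_m) n : 'I_m -> nat :=
  fun r => if r == j then (i j - n)%N else i r.

(** The terms where X multiplies a further derivative of an argument cancel between the two halves
    of the action. The X' terms shift the weight of the coefficient; X'' and X''' lower one index by
    1 and 2. *)
Lemma lie_op_diffop_mono w X a i : (forall j, (i j <= 2)%N) ->
  lie_op w X (diffop_mono a i) =
  diffop_mono (lie (w.2 - \sum_j ((i j)%:R + w.1 0 j)) X a) i
  - \sum_j diffop_mono (((i j == 2)%:R + (i j)%:R * w.1 0 j) *: (der (der X) * a))
                       (lower i j 1)
  - \sum_j diffop_mono (((i j == 2)%:R * w.1 0 j) *: (der (der (der X)) * a))
                       (lower i j 2).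
Proof.
move=> i2; apply/funext => phi.
pose P l := iter (i l) (@der R M) (phi l).
pose dP j := \prod_l (if l == j then der (P l) else P l).
have E0 : lie w.2 X (diffop_mono a i phi) =
    diffop_mono (lie w.2 X a) i phi + X * (a * \sum_j dP j).
  rewrite /diffop_mono !lieE derM der_prod -/dP; ring.
have E j : diffop_mono a i
      (fun l => if l == j then lie (w.1 0 j) X (phi j) else phi l) =
    X * (a * dP j) + diffop_mono (((i j)%:R + w.1 0 j) *: (der X * a)) i phi +
    diffop_mono (((i j == 2)%:R + (i j)%:R * w.1 0 j) *: (der (der X) * a))
      (lower i j 1) phi +
    diffop_mono (((i j == 2)%:R * w.1 0 j) *: (der (der (der X)) * a))
      (lower i j 2) phi.
  rewrite /diffop_mono /dP !(bigD1 j (P := predT)) //= /lower !eqxx iter_der_lie //.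
  rewrite subn1 subn2.
  pose B := \prod_(l | l != j) P l.
  have BE (F : 'I_m -> C) :
      (forall l, l != j -> F l = P l) -> \prod_(l | l != j) F l = B.
    by move=> FP; apply: eq_bigr.
  rewrite !BE; try by move=> l /negPf H; rewrite ?H.
  rewrite /P !scale_in_alg; ring.
pose c1 j := ((i j)%:R + w.1 0 j).
pose m1 j := diffop_mono (((i j == 2)%:R + (i j)%:R * w.1 0 j) *: (der (der X) * a))
  (lower i j 1).
pose m2 j := diffop_mono (((i j == 2)%:R * w.1 0 j) *: (der (der (der X)) * a))
  (lower i j 2).
transitivity (diffop_mono (lie (w.2 - \sum_j c1 j) X a) i phi -
  \sum_j m1 j phi - \sum_j m2 j phi); last first.
  have sumE (f : 'I_m -> op R M m) : (\sum_j f j) phi = \sum_j f j phi.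
    by rewrite fct_sumE.
  by rewrite -!sumE.
rewrite /lie_op E0.
have -> : \sum_j diffop_mono a i
      (fun l => if l == j then lie (w.1 0 j) X (phi j) else phi l) =
    X * (a * \sum_j dP j) + \sum_j diffop_mono (c1 j *: (der X * a)) i phi +
    \sum_j m1 j phi + \sum_j m2 j phi.
  by rewrite !mulr_sumr -!big_split; apply: eq_bigr => j _; exact: E.
have -> : diffop_mono (lie (w.2 - \sum_j c1 j) X a) i phi =
    diffop_mono (lie w.2 X a) i phi - \sum_j diffop_mono (c1 j *: (der X * a)) i phi.
  rewrite /diffop_mono -mulr_suml -mulrBl -scaler_suml; congr (_ * _).
  by rewrite !lieE !scale_in_alg !mulr1; ring.
move: (X * _) (diffop_mono _ _ _) => x y.
move: (\sum_j m1 j phi) (\sum_j m2 j phi) => z1 z2.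
move: (\sum_j diffop_mono _ _ _) => z.
by ring.
Qed.

Definition one_at (j : 'I_m) : 'I_m -> nat := fun r => (r == j).
Definition two_at (p : 'I_m * 'I_m) : 'I_m -> nat :=
  fun r => ((r == p.1) + (r == p.2))%N.

(** [kappa] and [theta] are the K and Q of [rho] for actual operators. On the diagonal [kappa] is 2
    lambda_j + 1, the X'' coefficient for a second derivative. *)
Definition kappa w (p : 'I_m * 'I_m) (j : 'I_m) : R :=
  w.1 0 p.1 * (j == p.2)%:R + w.1 0 p.2 * (j == p.1)%:R +
  (p.1 == p.2)%:R * (j == p.1)%:R.
Definition theta w (p : 'I_m * 'I_m) : R := (p.1 == p.2)%:R * w.1 0 p.1.

Lemma diffop_mono_linear i r a b :
  diffop_mono (r *: a + b) i = r *: diffop_mono a i + diffop_mono b i.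
Proof. by apply/funext => phi; rewrite /diffop_mono mulrDl -scalerAl. Qed.

Lemma diffop_mono0 i : diffop_mono (0 : C) i = 0.
Proof. by apply/funext => phi; rewrite /diffop_mono mul0r. Qed.

Lemma lie_op_zeroth w X a : lie_op w X (diffop_mono a (fun=> 0%N)) =
  diffop_mono (lie (weight_shift w) X a) (fun=> 0%N).
Proof.
rewrite lie_op_diffop_mono // [X in _ - X]big1 ?subr0; last first.
  by move=> j _; rewrite mul0r scale0r diffop_mono0.
rewrite [X in _ - X]big1 ?subr0; last first.
  by move=> j _; rewrite !mul0r addr0 scale0r diffop_mono0.
by rewrite /weight_shift; under eq_bigr do rewrite add0r.
Qed.

Lemma lie_op_first w X a j : lie_op w X (diffop_mono a (one_at j)) =
  diffop_mono (lie (weight_shift w - 1) X a) (one_at j) -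
  diffop_mono (w.1 0 j *: (der (der X) * a)) (fun=> 0%N).
Proof.
rewrite lie_op_diffop_mono; last by move=> r; rewrite /one_at; case: (r == j).
have n2 r : (one_at j r == 2)%N = false by rewrite /one_at; case: (r == j).
rewrite [\sum_j0 diffop_mono _ (lower _ _ 2)]big1 ?subr0; last first.
  by move=> r _; rewrite n2 mul0r scale0r diffop_mono0.
rewrite [\sum_j0 diffop_mono _ (lower _ _ 1)](bigD1 j) //=.
rewrite [\sum_(j0 < m | _) diffop_mono _ _]big1 ?addr0; last first.
  by move=> r /negPf rj; rewrite n2 /one_at rj !mul0r addr0 scale0r diffop_mono0.
have jj : one_at j j = 1%N by rewrite /one_at eqxx.
rewrite n2 jj add0r mul1r.
have -> : w.2 - \sum_r ((one_at j r)%:R + w.1 0 r) = weight_shift w - 1.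
  rewrite big_split /= /weight_shift opprD addrA addrAC; congr (_ - _ - _).
  by rewrite (bigD1 j) //= big1 /one_at ?eqxx ?addr0 // => r /negPf ->.
have -> // : lower (one_at j) j 1 = fun=> 0%N.
by apply/funext => r; rewrite /lower /one_at eqxx subnn; case: (r == j).
Qed.

Lemma lie_op_second w X a p : lie_op w X (diffop_mono a (two_at p)) =
  diffop_mono (lie (weight_shift w - 2) X a) (two_at p) -
  \sum_j diffop_mono (kappa w p j *: (der (der X) * a)) (one_at j) -
  diffop_mono (theta w p *: (der (der (der X)) * a)) (fun=> 0%N).
Proof.
have i2 r : (two_at p r <= 2)%N by rewrite /two_at; case: (r == p.1) (r == p.2) => -[].
rewrite lie_op_diffop_mono //; case: p i2 => j l i2.
have -> : \sum_r ((two_at (j, l) r)%:R + w.1 0 r) = 2 + \sum_r w.1 0 r.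
  rewrite big_split /=; congr (_ + _).
  rewrite /two_at /=; under eq_bigr do rewrite natrD.
  have E (q : 'I_m) : \sum_r (r == q)%:R = 1 :> R.
    by rewrite (bigD1 q) //= eqxx big1 ?addr0 // => r /negPf ->.
  by rewrite big_split /= !E.
have -> : w.2 - (2 + \sum_r w.1 0 r) = weight_shift w - 2.
  by rewrite /weight_shift; ring.
have Z c b i : diffop_mono (c *: b) i = c *: diffop_mono b i.
  by apply/funext => phi; rewrite /diffop_mono -scalerAl.
(* Single terms become sums against indicators, so that both sides can be compared index by
   index. *)
have E (q : 'I_m) c (g : op R M m) : \sum_r (c * (r == q)%:R) *: g = c *: g.
  rewrite (bigD1 q) //= eqxx mulr1 big1 ?addr0 // => r /negPf ->.
  by rewrite mulr0 scale0r.
congr (_ - _ - _).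
- pose f r := diffop_mono (der (der X) * a) (one_at r).
  have -> : \sum_r diffop_mono (kappa w (j, l) r *: (der (der X) * a)) (one_at r) =
      w.1 0 j *: f l + w.1 0 l *: f j + (j == l)%:R *: f j.
    rewrite -(E l _ (f l)) -2!(E j _ (f j)) -!big_split; apply: eq_bigr => r _ /=.
    rewrite Z /kappa !scalerDl /=; congr (_ + _ + _); rewrite -/(f r).
    - by case: eqP => [->//|_]; rewrite mulr0 !scale0r.
    - by case: eqP => [->//|_]; rewrite mulr0 !scale0r.
    - by case: (r =P j) => [->//|_]; rewrite mulr0 !scale0r.
  rewrite -(E j _ (f l)) -(E l (w.1 0 l) (f j)) -(E j _ (f j)) -!big_split.
  apply: eq_bigr => r _ /=; rewrite Z /two_at /=.
  case: (eqVneq r j) => [->|rj]; case: (eqVneq _ l) => [jl|rl] /=.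
  + rewrite -jl /lower eqxx !addn1 mulr1 -!scalerDl; congr (_ *: diffop_mono _ _).
      by ring.
    by apply/funext => q; rewrite /one_at; case: eqP => // ->; rewrite eqxx.
  + rewrite addn0 add0r mul1r !mulr1 !mulr0 scale0r !addr0.
    congr (_ *: diffop_mono _ _); apply/funext => q; rewrite /lower /one_at.
    by case: (eqVneq q j) => [->|_ //]; rewrite eqxx (negPf rl).
  + rewrite add0n add0r mul1r !mulr1 !mulr0 !scale0r add0r addr0.
    congr (_ *: diffop_mono _ _); first by rewrite jl.
    apply/funext => q; rewrite /lower /one_at jl.
    by case: (eqVneq q l) => [->|_]; rewrite ?eqxx ?addn1 ?subn1 ?addn0.
  + by rewrite mul0r !mulr0 !scale0r !addr0 scale0r.
- rewrite Z -(E j) /theta /=; apply: eq_bigr => r _; rewrite Z /two_at /=.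
  case: (eqVneq r j) => [->|rj]; last first.
    by case: (r == l); rewrite /= ?mulr0 mul0r !scale0r.
  case: (eqVneq j l) => [jl|_] /=; last by rewrite !mul0r !scale0r.
  rewrite mulr1; congr (_ *: diffop_mono _ _); apply/funext => q.
  by rewrite /lower -jl eqxx; case: eqP.
Qed.

End Monomials.

(** * Operators of order at most k as triples of coefficients *)

Section Quantization.
Variables (R : realType) (M : curve) (m k : nat).
Hypotheses (k_gt0 : (0 < k)%N) (k_le2 : (k <= 2)%N).
Local Notation C := (cinf R M).

(* The quadratic monomials are indexed by the pairs j <= l; there are none when
   k = 1. *)
Definition pairs : finType :=
  {p : 'I_m * 'I_m | (p.1 <= p.2)%N && (k == 2)}.

Local Notation V := (symbols R M m pairs).

Definition symbol_op (v : V) : op R M m :=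
  \sum_p diffop_mono (v.1.1 p) (two_at (val p)) +
  \sum_j diffop_mono (v.1.2 j) (one_at j) + diffop_mono v.2 (fun=> 0%N).

Lemma sum_one_at (j : 'I_m) : (\sum_r one_at j r = 1)%N.
Proof. by rewrite (bigD1 j) //= /one_at eqxx big1 // => r /negPf ->. Qed.

Lemma sum_two_at (p : 'I_m * 'I_m) : (\sum_r two_at p r = 2)%N.
Proof. by rewrite big_split /= !sum_one_at. Qed.

Lemma symbol_op_diffop v : symbol_op v \in diffop_pred k.
Proof.
rewrite /symbol_op !rpredD //.
- apply: rpred_sum => p _; apply/diffopP/mono_diffop; rewrite sum_two_at.
  by have /andP[_ /eqP ->] := valP p.
- by apply: rpred_sum => j _; apply/diffopP/mono_diffop; rewrite sum_one_at.
- by apply/diffopP/mono_diffop; rewrite big1.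
Qed.

Definition quantize (v : V) : diffop R M m k := Diffop (symbol_op_diffop v).

Lemma symbol_op_linear : linear symbol_op.
Proof.
move=> r [[a b] c] [[a' b'] c']; rewrite /symbol_op [LHS]/=.
have E (I : finType) (f g : I -> C) (e : I -> 'I_m -> nat) :
    \sum_q diffop_mono (r *: f q + g q) (e q) =
    r *: (\sum_q diffop_mono (f q) (e q)) + \sum_q diffop_mono (g q) (e q).
  by rewrite scaler_sumr -big_split; apply: eq_bigr => q _; rewrite diffop_mono_linear.
transitivity ((r *: (\sum_p diffop_mono (a p) (two_at (val p))) +
     \sum_p diffop_mono (a' p) (two_at (val p))) +
  (r *: (\sum_j diffop_mono (b j) (one_at j)) + \sum_j diffop_mono (b' j) (one_at j))
  + (r *: diffop_mono c (fun=> 0%N) + diffop_mono c' (fun=> 0%N))).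
  by rewrite -!E -diffop_mono_linear.
by rewrite !scaler_addACA.
Qed.

Lemma quantize_linear : linear quantize.
Proof. by move=> r u v; apply/val_inj; exact: symbol_op_linear. Qed.

Definition weight_action (w : weights R m) : C -> V -> V :=
  rho (weight_shift w) (fun p => kappa w (val p)) (w.1 0) (fun p => theta w (val p)).

Lemma symbol_op_rho w X v : lie_op w X (symbol_op v) = symbol_op (weight_action w X v).
Proof.
have mB i (f g : C) : diffop_mono (f - g) i = diffop_mono f i - diffop_mono g i.
  by apply/funext => phi; rewrite /diffop_mono mulrBl.
have mS (I : finType) i (f : I -> C) :
    diffop_mono (\sum_q f q) i = \sum_q diffop_mono (f q) i.
  by apply/funext => phi; rewrite /diffop_mono mulr_suml fct_sumE.
case: v => [[a b] c]; set d := weight_shift w.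
pose A p := diffop_mono (lie (d - 2) X (a p)) (two_at (val p)).
pose B p j := diffop_mono (kappa w (val p) j *: (der (der X) * a p)) (one_at j).
pose D p : op R M m :=
  diffop_mono (theta w (val p) *: (der (der (der X)) * a p)) (fun=> 0%N).
pose E j := diffop_mono (lie (d - 1) X (b j)) (one_at j).
pose F j : op R M m := diffop_mono (w.1 0 j *: (der (der X) * b j)) (fun=> 0%N).
pose G : op R M m := diffop_mono (lie d X c) (fun=> 0%N).
transitivity (\sum_p (A p - \sum_j B p j - D p) + \sum_j (E j - F j) + G).
  have LD (f g : op R M m) : lie_op w X (f + g) = lie_op w X f + lie_op w X g.
    exact: linearD.
  have LS (I : finType) (f : I -> op R M m) :
      lie_op w X (\sum_q f q) = \sum_q lie_op w X (f q).
    exact: linear_sum.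
  rewrite /symbol_op !LD !LS lie_op_zeroth; congr (_ + _ + _).
    by apply: eq_bigr => p _; rewrite lie_op_second.
  by apply: eq_bigr => j _; rewrite lie_op_first.
transitivity (\sum_p A p + \sum_j (E j - \sum_p B p j) +
    (G - \sum_j F j - \sum_p D p)).
  rewrite !sumrB [\sum_j \sum_p B p j]exchange_big /=.
  by rewrite (AC (3*2*1) (1*(4*2)*(6*5*3))).
rewrite /symbol_op; congr (_ + _ + _).
  by apply: eq_bigr => j _; rewrite /E /B -mS -mB.
by rewrite /G /F /D -!mS -!mB.
Qed.

(** Test arguments equal to 1 isolate coefficients: they kill every monomial that differentiates
    them. *)
Lemma diffop_mono_eq0 (x : C) (i : 'I_m -> nat) phi r :
  phi r = 1 -> (0 < i r)%N -> diffop_mono x i phi = 0.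
Proof.
move=> p1 i0; rewrite /diffop_mono (bigD1 r) //= p1; case: (i r) i0 => // n _.
suff -> : iter n.+1 (@der R M) 1 = 0 by rewrite mul0r mulr0.
by rewrite iterSr der1; elim: n => // n IH; rewrite iterS IH der0.
Qed.

(** A linear system in x and y with determinant cos^2 + sin^2 = 1. *)
Lemma cos_sin_eq0 (x y : C) :
  x * sinM = y * cosM -> x * cosM = - (y * sinM) -> x = 0 /\ y = 0.
Proof.
move=> e1 e2; have cs := cosM2_sinM2 R M; split.
  rewrite -[x]mulr1 -cs mulrDr !mulrA e1 e2; ring.
have f1 : y * cosM * cosM = x * sinM * cosM by rewrite e1.
have f2 : y * sinM * sinM = - (x * cosM * sinM) by rewrite e2 mulNr opprK.
by rewrite -[y]mulr1 -cs mulrDr !mulrA f1 f2; ring.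
Qed.

Section Kernel.
Variable v : V.
Hypothesis v0 : symbol_op v = 0.

Let v0E phi : \sum_p diffop_mono (v.1.1 p) (two_at (val p)) phi +
  \sum_j diffop_mono (v.1.2 j) (one_at j) phi + diffop_mono v.2 (fun=> 0%N) phi = 0.
Proof.
transitivity (symbol_op v phi); last by rewrite v0.
have sumE (I : finType) (f : I -> op R M m) : (\sum_j f j) phi = \sum_j f j phi.
  by rewrite fct_sumE.
rewrite -(sumE _ (fun p => diffop_mono (v.1.1 p) (two_at (val p)))).
by rewrite -(sumE _ (fun j => diffop_mono (v.1.2 j) (one_at j))).
Qed.

Let v2_0 : v.2 = 0.
Proof.
have := v0E (fun=> 1); rewrite !big1 ?add0r => [||].
- by rewrite /diffop_mono big1 ?mulr1.
- by move=> j _; apply: (@diffop_mono_eq0 _ _ _ j) => //; rewrite /one_at eqxx.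
- by move=> p _; apply: (@diffop_mono_eq0 _ _ _ (val p).1) => //; rewrite /two_at eqxx.
Qed.

Let diffop_mono0z i : diffop_mono v.2 i = 0 :> op R M m.
Proof. by rewrite v2_0 diffop_mono0. Qed.

(** Written as a sum to cover both orders: it has one term if k = 2 and none if k = 1. *)
Let diag (j : 'I_m) := \sum_(p : pairs | val p == (j, j)) v.1.1 p.

(** Put f in position j and 1 elsewhere: only pure derivatives of that argument survive. *)
Let diagE j (f : C) : diag j * der (der f) + v.1.2 j * der f = 0.
Proof.
pose phi r := if r == j then f else 1.
have phi1 r : r != j -> phi r = 1 by rewrite /phi => /negPf ->.
rewrite -(v0E phi) diffop_mono0z addr0; congr (_ + _).
  rewrite /diag mulr_suml big_mkcond /=; apply: eq_bigr => p _.
  case: eqP => [->|/eqP pj].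
    rewrite /diffop_mono (bigD1 j) //= /phi eqxx big1; last first.
      by move=> r /negPf rj; rewrite /two_at /= rj.
    by rewrite mulr1 /two_at /= eqxx.
  have [p1|p1] := eqVneq (val p).1 j; last first.
    by rewrite (@diffop_mono_eq0 _ _ _ _ (phi1 _ p1)) // /two_at eqxx.
  have p2 : (val p).2 != j.
    by apply: contra pj => /eqP p2;
      rewrite -[X in _ == (X, _)]p1 -[X in _ == (_, X)]p2 -surjective_pairing.
  by rewrite (@diffop_mono_eq0 _ _ _ _ (phi1 _ p2)) // /two_at eqxx addn1.
rewrite (bigD1 j) //= big1 ?addr0; last first.
  by move=> r /phi1 r1; rewrite (@diffop_mono_eq0 _ _ _ _ r1) // /one_at eqxx.
rewrite /diffop_mono (bigD1 j) //= /phi eqxx big1; last first.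
  by move=> r /negPf rj; rewrite /one_at rj.
by rewrite mulr1 /one_at eqxx.
Qed.

Let diag_eq0 j : diag j = 0 /\ v.1.2 j = 0.
Proof.
have := diagE j sinM; have := diagE j cosM; rewrite !derE => e1 e2.
apply: cos_sin_eq0.
  by apply/eqP; rewrite -subr_eq0 -oppr_eq0; apply/eqP; rewrite -e2; ring.
by apply/eqP; rewrite -subr_eq0 opprK -oppr_eq0; apply/eqP; rewrite -e1; ring.
Qed.

Let diag_coef (p : pairs) : (val p).1 = (val p).2 -> v.1.1 p = 0.
Proof.
move=> p12; have [<- _] := diag_eq0 (val p).1.
have -> : diag (val p).1 = \sum_(q : pairs | val q == val p) v.1.1 q.
  by rewrite /diag {2}p12 -surjective_pairing.
by rewrite (big_pred1 p) // => q; exact: val_eqE.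
Qed.

(** Put f in both positions of p and 1 elsewhere: pure derivatives already have coefficient zero, so
    only the mixed monomial of p survives. *)
Let off_diagE p (f : C) : (val p).1 != (val p).2 -> v.1.1 p * (der f * der f) = 0.
Proof.
move=> p12; have p21 : ((val p).2 == (val p).1) = false.
  by rewrite eq_sym (negPf p12).
pose phi r := if (r == (val p).1) || (r == (val p).2) then f else 1.
have phi1 r : r != (val p).1 -> r != (val p).2 -> phi r = 1.
  by rewrite /phi => /negPf -> /negPf ->.
rewrite -(v0E phi) diffop_mono0z addr0 [X in _ + X]big1 ?addr0; last first.
  by move=> j _; have [_ ->] := diag_eq0 j; rewrite diffop_mono0.
rewrite (bigD1 p) //= big1 ?addr0.
  rewrite /diffop_mono (bigD1 (val p).1) //= (bigD1 (val p).2) 1?eq_sym //= big1.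
    by rewrite mulr1 /phi /two_at !eqxx orbT /= (negPf p12) p21.
  move=> r /andP[/negPf r1 /negPf r2]; by rewrite /phi /two_at r1 r2.
move=> q qp; have [q12|q12] := eqVneq (val q).1 (val q).2.
  by rewrite diag_coef // diffop_mono0.
have out r : (0 < two_at (val q) r)%N -> r != (val p).1 -> r != (val p).2 ->
    diffop_mono (v.1.1 q) (two_at (val q)) phi = 0.
  by move=> qr r1 r2; apply: (@diffop_mono_eq0 _ _ _ r) => //; exact: phi1.
have q1 : (0 < two_at (val q) (val q).1)%N by rewrite /two_at eqxx.
have q2 : (0 < two_at (val q) (val q).2)%N by rewrite /two_at eqxx addn1.
have [e11|n11] := eqVneq (val q).1 (val p).1.
  have [e22|n22] := eqVneq (val q).2 (val p).2.
    case/eqP: qp; apply/val_inj; rewrite [LHS]surjective_pairing.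
    by rewrite e11 e22 -surjective_pairing.
  by apply: (out _ q2) => //; rewrite -e11 eq_sym.
have [e12|n12] := eqVneq (val q).1 (val p).2; last exact: (out _ q1).
have [e21|n21] := eqVneq (val q).2 (val p).1; last first.
  by apply: (out _ q2) => //; rewrite -e12 eq_sym.
(* What remains is q equal to p reversed, which the ordering of the pairs rules out. *)
have /andP[qo _] := valP q; have /andP[po _] := valP p.
case/eqP: p12; apply/val_inj/eqP; rewrite eqn_leq po /=.
by rewrite -e12 -e21.
Qed.

Lemma symbol_op_eq0 : v = 0.
Proof.
apply: symbols_eq => [p|j|]; [|exact: (diag_eq0 j).2|exact: v2_0].
have [p12|p12] := eqVneq (val p).1 (val p).2; last first.
  have := off_diagE sinM p12; have := off_diagE cosM p12; rewrite !derE mulrNN => e1 e2.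
  by rewrite -[LHS]mulr1 -(cosM2_sinM2 R M) mulrDr e1 e2 addr0.
exact: diag_coef.
Qed.

End Kernel.

Lemma quantize_inj : injective quantize.
Proof.
move=> u v /(congr1 val) /= uv; apply/eqP; rewrite -subr_eq0; apply/eqP.
apply: symbol_op_eq0; rewrite -[u - v]addrC -scaleN1r symbol_op_linear uv.
by rewrite scaleN1r addNr.
Qed.

Lemma sum_eq_succ (i : 'I_m -> nat) n : (\sum_r i r = n.+1)%N ->
  exists j i', i = (fun r => i' r + one_at j r)%N /\ (\sum_r i' r = n)%N.
Proof.
move=> i1; have [j ij] : exists j, (0 < i j)%N.
  apply: contrapT => H; move: i1; rewrite big1 // => j _.
  by apply/eqP; rewrite -leqn0 leqNgt; apply/negP => ij; apply: H; exists j.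
exists j, (lower i j 1); have E : i = (fun r => lower i j 1 r + one_at j r)%N.
  apply/funext => r; rewrite /lower /one_at.
  by case: eqP => [->|_]; rewrite ?addn0 ?subn1 ?addn1 ?prednK.
by split=> //; move: i1; rewrite {1}E big_split /= sum_one_at addn1 => -[].
Qed.

Lemma sum_eq0 (i : 'I_m -> nat) : (\sum_r i r = 0)%N -> i = fun=> 0%N.
Proof.
move=> /eqP; rewrite sum_nat_eq0 => /forallP i0; apply/funext => r.
by apply/eqP; exact: i0.
Qed.

Lemma symbol_op_mono x (i : 'I_m -> nat) : (\sum_r i r <= k)%N ->
  exists v, symbol_op v = diffop_mono x i.
Proof.
have one (I : finType) (p : I) (e : I -> 'I_m -> nat) :
    \sum_q diffop_mono (if q == p then x else 0) (e q) = diffop_mono x (e p).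
  rewrite (bigD1 p) //= eqxx big1 ?addr0 // => q /negPf ->.
  by rewrite diffop_mono0.
have zero (I : finType) (e : I -> 'I_m -> nat) : \sum_q diffop_mono (0 : C) (e q) = 0.
  by rewrite big1 // => q _; rewrite diffop_mono0.
case E: (\sum_r i r)%N => [|[|[|n]]] ik.
- exists (0, 0, x); rewrite /symbol_op /= !zero !add0r.
  by rewrite (sum_eq0 E).
- have [j [i' [-> /sum_eq0 ->]]] := sum_eq_succ E.
  exists (0, (fun r => if r == j then x else 0), 0).
  by rewrite /symbol_op /= zero one diffop_mono0 addr0 add0r.
- have k2 : k == 2%N by rewrite eqn_leq k_le2.
  have [j [i' [-> /sum_eq_succ[l [i'' [-> /sum_eq0 ->]]]]]] := sum_eq_succ E.
  have [p pE] : exists p : pairs, two_at (val p) = (fun r => 0 + one_at l r + one_at j r)%N.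
    have [jl|jl] := leqP l j.
      have pP : (l <= j)%N && (k == 2) by rewrite jl.
      by exists (exist _ (l, j) pP).
    have pP : (j <= l)%N && (k == 2) by rewrite ltnW.
    by exists (exist _ (j, l) pP); apply/funext => r; rewrite /two_at /= addnC.
  exists ((fun q => if q == p then x else 0), 0, 0).
  by rewrite /symbol_op /= (one _ _ (fun q => two_at (val q))) zero diffop_mono0 !addr0 pE.
- by have := leq_trans ik k_le2.
Qed.

Lemma quantize_surj A : exists v, quantize v = A.
Proof.
have [a aE] := diffopP k A (valP A).
have [v vE] : exists v, symbol_op v =
    \sum_(i : midx m k | (\sum_j i j <= k)%N) diffop_mono (a i) (fun j => i j).
  elim/big_ind: _ => [|_ _ [u <-] [v <-]|i ik].
  - by exists ((-1) *: 0 + 0); rewrite symbol_op_linear scaleN1r addNr.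
  - by exists (u + v); have := symbol_op_linear 1 u v; rewrite !scale1r.
  - exact: symbol_op_mono.
exists v; apply/val_inj/funext => phi; rewrite /= vE aE.
by rewrite fct_sumE.
Qed.

Lemma weight_action_iso w : module_iso (weight_action w) (@act R M m k w).
Proof.
apply: (module_iso_linear (T := quantize)).
- exact: quantize_linear.
- pose S A := sval (cid (quantize_surj A)).
  have SK : cancel S quantize by move=> A; rewrite /S; case: cid.
  by exists S => // v; apply: quantize_inj; rewrite SK.
- by move=> X v; apply/val_inj; rewrite /= symbol_op_rho.
Qed.

End Quantization.

(** * Exceptional weights and the vanishing of the cocycle *)

Section Classification.
Variables (R : realType) (M : curve) (m : nat).
Implicit Types (w v : weights R m) (d : R).

Lemma obtained_trans w v u : obtained w v -> obtained v u -> obtained w u.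
Proof.
move=> wv; elim => // [i j x _ | i1 x i10 _]; first exact: obtained_perm.
exact: obtained_conj.
Qed.

Lemma obtained_swap w d (i j : 'I_m) :
  obtained w (d *: delta_mx 0 i, 1) -> obtained w (d *: delta_mx 0 j, 1).
Proof.
move=> /(obtained_perm i j) /=.
suff -> : xcol i j (d *: delta_mx 0 i) = d *: delta_mx 0 j :> 'rV[R]_m by [].
have E l : (tperm i j l == i) = (l == j).
  by rewrite -{2}(tpermR i j) (inj_eq perm_inj).
by apply/rowP => l; rewrite !mxE /= E.
Qed.

(** Conjugating (0; d) gives 1 - d in the last position and target weight 1; conjugating with 1 - d
    in the first position gives back (0; d). Permutations move the entry. *)
Lemma obtained_exceptional d w v : (1 <= m)%N ->
  exceptional d w -> exceptional d v -> obtained w v.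
Proof.
move=> hm; pose i1 : 'I_m := Ordinal hm; pose i2 := rev_ord i1.
have to_delta j : obtained ((0, d) : weights R m) ((1 - d) *: delta_mx 0 j, 1).
  apply: (@obtained_swap _ _ i2 j).
  have := obtained_conj (erefl : i1 = 0%N :> nat) (obtained_refl (0 : 'rV[R]_m, d)).
  rewrite /conj_weights /=.
  have -> : 1 - (0 : 'rV[R]_m) 0 i1 = 1 by rewrite mxE subr0.
  suff -> : \row_j (if (j.+1 < m)%N then (0 : 'rV[R]_m) 0 (ordS j) else 1 - d) =
    (1 - d) *: delta_mx 0 i2 by move=> h; exact: h.
  apply/rowP => l; rewrite !mxE /= -val_eqE /= subn1.
  case: ltnP => lm.
    by rewrite ltn_eqF ?mulr0 // -ltnS prednK.
  by rewrite -eqSS prednK // eqn_leq ltn_ord lm mulr1.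
have from_delta j : obtained (((1 - d) *: delta_mx 0 j, 1) : weights R m) (0, d).
  have := obtained_swap i1 (obtained_refl ((1 - d) *: delta_mx 0 j : 'rV[R]_m, 1)).
  move=> /(obtained_conj (erefl : i1 = 0%N :> nat)); rewrite /conj_weights /=.
  have -> : 1 - ((1 - d) *: delta_mx 0 i1 : 'rV[R]_m) 0 i1 = d.
    by rewrite !mxE !eqxx mulr1; ring.
  suff -> : \row_j (if (j.+1 < m)%N then
      ((1 - d) *: delta_mx 0 i1 : 'rV[R]_m) 0 (ordS j) else 1 - 1) = 0 by move=> h; exact: h.
  apply/rowP => l; rewrite !mxE /= subrr; case: ifP => // lm.
  (* Below the last position [ordS] does not wrap around, so it misses the first index. *)
  by rewrite -val_eqE /= modn_small // mulr0.
by case=> [->|[j ->]]; case=> [->|[l ->]];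
  [exact: obtained_refl|exact: to_delta|exact: from_delta
  |exact: obtained_trans (from_delta j) (to_delta l)].
Qed.

(** The coefficient of X''' that [rho_normal] leaves for the weights w. *)
Definition obstruction w (p : 'I_m * 'I_m) : R :=
  theta w p + (\sum_j w.1 0 j * kappa w p j) / (2 * weight_shift w - 3).

Lemma sum_kappa w p : \sum_j w.1 0 j * kappa w p j =
  2 * (w.1 0 p.1 * w.1 0 p.2) + theta w p.
Proof.
have E (q : 'I_m) c : \sum_j w.1 0 j * (c * (j == q)%:R) = w.1 0 q * c.
  rewrite (bigD1 q) //= eqxx mulr1 big1 ?addr0 // => j /negPf ->.
  by rewrite !mulr0.
under eq_bigr do rewrite /kappa !mulrDr.
by rewrite !big_split /= !E /theta; ring.
Qed.

(** Up to the factor 2 / (2 d - 3), the obstruction is lambda_j (lambda_j + d - 1) on the diagonal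
    and lambda_j lambda_l off it. So all vanish exactly when lambda is 0 or has a single nonzero
    entry, equal to 1 - d; the shift then determines mu. *)
Lemma obstruction_exceptional d w : 2 * d <> 3 -> weight_shift w = d ->
  (forall p : pairs m 2, obstruction w (val p) = 0) <-> exceptional d w.
Proof.
move=> d3 sw; have {}d3 : 2 * d - 3 != 0 by apply/eqP => /subr0_eq.
have diagE j : obstruction w (j, j) = 2 * (w.1 0 j * (w.1 0 j + d - 1)) / (2 * d - 3).
  by rewrite /obstruction sum_kappa /theta sw /= eqxx !mul1r; field.
have offE j l : j != l -> obstruction w (j, l) = 2 * (w.1 0 j * w.1 0 l) / (2 * d - 3).
  by rewrite /obstruction sum_kappa /theta sw /= => /negPf ->; rewrite !mul0r add0r addr0.
have eq0 (x : R) : (2 * x / (2 * d - 3) == 0) = (x == 0).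
  by rewrite !mulf_eq0 invr_eq0 (negPf d3) orbF pnatr_eq0.
split=> [H|].
  (* The obstruction is symmetric in j and l, so ordered pairs suffice. *)
  have H' j l : obstruction w (j, l) = 0.
    wlog jl : j l / (j <= l)%N.
      move=> H'; have [|/ltnW lj] := leqP j l; first exact: H'.
      by rewrite -(H' _ _ lj) /obstruction !sum_kappa /theta /=; case: (eqVneq j l) => [->|_] //;
        rewrite !mul0r [w.1 0 j * _]mulrC.
    have pP : (j <= l)%N && (2 == 2)%N by rewrite jl.
    exact: (H (exist _ (j, l) pP)).
  have wE : w = (w.1, d + \sum_j w.1 0 j).
    by case: (w) sw => a b /= <-; rewrite /weight_shift subrK.
  have [w0|[j wj]] : (forall j, w.1 0 j = 0) \/ exists j, w.1 0 j != 0.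
  - case: (pselect (exists j, w.1 0 j != 0)) => [|nj]; [by right|left => j].
    by apply/eqP; apply: contrapT => wj; apply: nj; exists j; apply/negP.
  - left; rewrite wE big1 ?addr0 //; congr (_, _).
    by apply/rowP => j; rewrite mxE w0.
  - right; exists j.
    have wjE : w.1 0 j = 1 - d.
      have /eqP := H' j j; rewrite diagE eq0 mulf_eq0 (negPf wj) /= => /eqP e.
      by lra.
    have wl l : l != j -> w.1 0 l = 0.
      move=> lj; have /eqP := H' l j.
      by rewrite offE // eq0 mulf_eq0 (negPf wj) orbF => /eqP.
    rewrite wE (bigD1 j) //= big1 ?addr0 // wjE; congr (_, _); last by ring.
    apply/rowP => l; rewrite !mxE eqxx /=; case: eqVneq => [->|lj].
      by rewrite mulr1.
    by rewrite mulr0 wl.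
case=> [e|[q e]] [[j l] /= jl].
- have w0 r : w.1 0 r = 0 by rewrite e mxE.
  by rewrite /obstruction sum_kappa /theta /= !w0 !mulr0 addr0 mul0r addr0.
- have wE r : w.1 0 r = (1 - d) * (r == q)%:R by rewrite e !mxE eqxx.
  have [->|jl'] := eqVneq j l.
    by rewrite diagE wE; case: eqP => _ /=; field.
  rewrite offE // !wE; case: (eqVneq j q) => [<-|_].
    by rewrite eq_sym (negPf jl') !mulr0 mul0r.
  by rewrite mulr0 mul0r mulr0 mul0r.
Qed.

Lemma exceptional_shift d w : exceptional d w -> weight_shift w = d.
Proof.
rewrite /weight_shift => -[->|[j ->]] /=.
  by rewrite big1 ?subr0 // => j _; rewrite mxE.
rewrite (bigD1 j) //= big1 ?addr0 => [|l lj]; rewrite !mxE ?eqxx.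
  by rewrite mulr1; ring.
by rewrite (negPf lj) mulr0.
Qed.

Lemma act_normal_form k w : (0 < k <= 2)%N -> weight_shift w <> 1 ->
  (pairs m k -> weight_shift w <> 2 /\ 2 * weight_shift w <> 3) ->
  module_iso (@act R M m k w)
    (normal_form (m := m) (J := pairs m k) (weight_shift w) (fun p => obstruction w (val p))).
Proof.
move=> /andP[k0 k2] d1 d23.
apply: module_iso_trans (module_iso_sym (weight_action_iso M k0 k2 w)) _.
exact: rho_normal.
Qed.

End Classification.

Theorem theorem10p2 (R : realType) (M : curve) (m : nat) (hm : (1 <= m)%N)
    (delta : R) :
  (delta <> 1 ->
     forall w v : weights R m,
       weight_shift w = delta -> weight_shift v = delta ->
       isomorphic M 1 w v) /\
  (delta <> 1 -> delta <> 3 / 2 -> delta <> 2 ->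
     [/\ forall w v : weights R m,
           weight_shift w = delta -> weight_shift v = delta ->
           ~ exceptional delta w -> ~ exceptional delta v ->
           isomorphic M 2 w v,
         forall w v : weights R m,
           exceptional delta w -> exceptional delta v ->
           isomorphic M 2 w v
       & forall w : weights R m,
           exceptional delta w -> singular M 2 w]).
Proof.
split=> [d1 w v sw sv|d1 d32 d2].
  (* In order 1 there are no quadratic monomials, so the normal form depends on the shift alone. *)
  have no_pairs (p : pairs m 1) : False by case/andP: (valP p).
  have nf u : weight_shift u = delta -> module_iso (@act R M m 1 u)
      (normal_form (m := m) (J := pairs m 1) delta (fun=> 0)).
    move=> su; have := @act_normal_form R M m 1 u isT; rewrite su => /(_ d1).
    have -> : (fun p : pairs m 1 => obstruction u (val p)) = (fun=> 0).
      by apply/funext => p; case: (no_pairs p).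
    by apply => p; case: (no_pairs p).
  exact: module_iso_trans (nf w sw) (module_iso_sym (nf v sv)).
have d3 : 2 * delta <> 3 by move=> e; apply: d32; rewrite -e; field.
have nf u : weight_shift u = delta -> module_iso (@act R M m 2 u)
    (normal_form (m := m) (J := pairs m 2) delta (fun p => obstruction u (val p))).
  by move=> su; have := @act_normal_form R M m 2 u isT; rewrite su; apply.
have nf0 u : exceptional delta u ->
    module_iso (@act R M m 2 u) (normal_form (m := m) (J := pairs m 2) delta (fun=> 0)).
  move=> eu; have su := exceptional_shift eu; have := nf u su.
  have [_ /(_ eu) o] := obstruction_exceptional d3 su.
  by have -> : (fun p : pairs m 2 => obstruction u (val p)) = (fun=> 0) by exact/funext.
split.
- move=> w v sw sv nw nv.
  have pivot u : weight_shift u = delta -> ~ exceptional delta u ->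
      exists p : pairs m 2, obstruction u (val p) <> 0.
    move=> su nu; apply: contrapT => no; apply: nu.
    apply/(obstruction_exceptional d3 su) => p; apply: contrapT => po.
    by apply: no; exists p.
  have [p pw] := pivot w sw nw; have [q qv] := pivot v sv nv.
  exact: module_iso_trans (nf w sw) (module_iso_trans
    (normal_form_iso (Q := fun p => obstruction w (val p))
       (Q' := fun p => obstruction v (val p)) M m delta pw qv)
    (module_iso_sym (nf v sv))).
- by move=> w v ew ev; exact: module_iso_trans (nf0 w ew) (module_iso_sym (nf0 v ev)).
(* It suffices that v is exceptional, that is, has shift [delta] and zero obstruction. *)
move=> w ew v wv; apply: (obtained_exceptional hm ew).
have iso0 := module_iso_trans (module_iso_sym (nf0 w ew)) wv.
(* With its shift still unknown, v cannot be normalized, so its unreduced model is compared. *)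
have sv : weight_shift v = delta.
  apply: (normal_form_shift d1).
  by apply: module_iso_trans iso0 (module_iso_sym (weight_action_iso M _ _ v)).
apply/(obstruction_exceptional d3 sv).
exact: (normal_form_obstruction d1 d2 d3 (module_iso_trans iso0 (nf v sv))).
Qed.
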